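(* Let $X$ be a Banach space and let $(\xi_j)_{j\ge 1}$ be an i.i.d. sequence of symmetric random variables with finite moments of all orders and with $\mathbb{E}|\xi_j|^2=1$. The following assertions are equivalent: \begin{enumerate} \item[(1)] There exists a constant $K$ such that $$\Bigl(\mathbb{E}\Big\|\sum_{j=1}^n \xi_j f(x_j)\Big\|^2\Bigr)^{\frac12}\leq K \|f\|_{\rm Lip}\Bigl(\mathbb{E}\Big\|\sum_{j=1}^n \xi_j x_j\Big\|^2\Bigr)^{\frac12}$$ for all Lipschitz functions $f:X\to X$ satisfying $f(0)=0$ and all finite sequences $x_1,\dots,x_n$ in $X$. \item[(2)] $X$ is isomorphic to a Hilbert space. \end{enumerate}
   Context: For a Lipschitz function $f:X\to X$, $\|f\|_{\rm Lip}$ denotes its (best) Lipschitz constant. A random variable $\xi$ is symmetric if $\xi$ and $-\xi$ have the same distribution. ''Isomorphic'' means linearly homeomorphic, i.e. there is a bounded linear bijection with bounded inverse. *)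

(* Defs.v *)
From HB Require Import structures.
From mathcomp Require Import all_boot all_order all_algebra.
From mathcomp Require Import finmap complex.
From mathcomp Require Import all_classical all_reals all_analysis.

Set Implicit Arguments.
Unset Strict Implicit.
Unset Printing Implicit Defensive.

Import Order.TTheory GRing.Theory Num.Theory.
Import numFieldNormedType.Exports.

Local Open Scope classical_set_scope.
Local Open Scope ring_scope.

Variant scalars := RealScalars | ComplexScalars.

Definition scalar_field (R : realType) (s : scalars) : numFieldType :=
  match s with RealScalars => R | ComplexScalars => R[i] end.

Definition of_real (R : realType) (s : scalars) : R -> scalar_field R s :=
  match s with RealScalars => idfun | ComplexScalars => fun r => r%:C%C end.

Definition scalar_conj (R : realType) (s : scalars) :
    scalar_field R s -> scalar_field R s :=
  match s with RealScalars => idfun | ComplexScalars => fun z => (z^*)%C end.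

Definition scalar_re (R : realType) (s : scalars) : scalar_field R s -> R :=
  match s with RealScalars => idfun | ComplexScalars => fun z => complex.Re z end.

(* The library norm of a normed space over [K] takes its values in [K]; for
   [K = R[i]] these values have zero imaginary part. *)
Definition rnorm (R : realType) (s : scalars)
    (X : normedModType (scalar_field R s)) (x : X) : R :=
  scalar_re `|x|.

Definition lip_const (R : realType) (s : scalars)
    (X Y : normedModType (scalar_field R s)) (f : X -> Y) : R :=
  inf [set L : R | 0 <= L /\ (of_real s L).-lipschitz f].

(* [{dot H for _}] is linear in its first argument, conjugate-linear in its
   second one, Hermitian symmetric and positive definite. *)
Definition is_hilbert (R : realType) (s : scalars)
    (H : completeNormedModType (scalar_field R s)) : Prop :=
  exists ip : {dot H for @scalar_conj R s}, forall x : H, `|x| ^+ 2 = ip x x.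

Definition isomorphic (K : numFieldType) (X Y : normedModType K) : Prop :=
  exists (T : {linear X -> Y}) (S : {linear Y -> X}),
    [/\ cancel T S, cancel S T, continuous T & continuous S].

Definition isomorphic_to_hilbert (R : realType) (s : scalars)
    (X : completeNormedModType (scalar_field R s)) : Prop :=
  exists2 H : completeNormedModType (scalar_field R s),
    is_hilbert H & isomorphic X H.

Section random_variables.
Context d (T : measurableType d) (R : realType) (P : probability T R).
Local Open Scope ereal_scope.

Definition same_distribution (X Y : T -> R) : Prop :=
  forall A : set R, measurable A -> pushforward P X A = pushforward P Y A.

Definition symmetric_rv (X : {RV P >-> R}) : Prop :=
  same_distribution X (fun w => - X w)%R.

Definition independent_rvs (xi : nat -> {RV P >-> R}) : Prop :=
  forall (J : {fset nat}) (A : nat -> set R),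
    (forall j, j \in J -> measurable (A j)) ->
    P (\bigcap_(j in [set` J]) (xi j @^-1` A j)) =
    \prod_(j <- J) P (xi j @^-1` A j).

Definition iid (xi : nat -> {RV P >-> R}) : Prop :=
  independent_rvs xi /\ forall i j, same_distribution (xi i) (xi j).

Definition finite_moments (X : {RV P >-> R}) : Prop :=
  forall p : nat, 'E_P[(fun w => `|X w| ^+ p)%R] < +oo.

Definition random_sum_norm (s : scalars) (X : normedModType (scalar_field R s))
    (xi : nat -> {RV P >-> R}) (n : nat) (x : 'I_n -> X) : \bar R :=
  'E_P[(fun w => rnorm (\sum_(j < n) of_real s (xi j w) *: x j) ^+ 2)%R]
    `^ 2^-1.

End random_variables.

(* Main.v *)
(* Write [B(x)] for [E|sum eps_j x_j|^2] with independent signs [eps_j], and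
   [W(x)] for [sum |x_j|^2].  Since the [xi_j] are symmetric and independent,
   [E|sum xi_j x_j|^2] is the expectation of [B(xi_j x_j)].

   (1) => (2).  If type 2 (that is, [B <= T W]) failed, there would be finite
   sign sums [Y] whose norm is concentrated near 1 and whose independent copies
   satisfy [E|sum t_j Y_j|^2 <= 4 sum t_j^2].  Some realisation of the points
   [a_j Y_j] is then separated, so a Lipschitz sum of bumps maps it to any given
   [x_j] with [|x_j| = a_j], and (1) bounds [B(x)] by a multiple of [W(x)] after
   all.  Applying (1) to [x |-> |x| e] bounds [W(x)] by [E|sum xi_j x_j|^2], and
   truncating the [xi_j], with type 2 for the remainder, yields cotype 2:
   [W <= C B].

   Kwapien's theorem: by the law of large numbers, many copies of the pair
   [x + y, x - y] have asymptotically the same sign sums as equally many copies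
   of [x, x, y, y].  With type and cotype 2 it follows that [W(u) <= C T W(v)]
   whenever such rotations turn the family [u] into [v].  A Hahn-Banach argument on the
   free abelian group over [X] then provides [q] with
   [|x|^2 <= q(x) <= C T |x|^2] and the parallelogram identity, and Jordan and
   von Neumann give an equivalent Hilbert norm.

   (2) => (1).  In a Hilbert space [E|sum xi_j x_j|^2 = W(x)]. *)
Require Import Defs.
From HB Require Import structures.
From mathcomp Require Import all_boot all_order all_algebra.
From mathcomp Require Import finmap complex ring lra zify.
From mathcomp Require Import all_classical all_reals all_analysis.
From mathcomp Require Import measurable_realfun.

Set Implicit Arguments.
Unset Strict Implicit.
Unset Printing Implicit Defensive.

Import Order.TTheory GRing.Theory Num.Theory.
Import numFieldNormedType.Exports.

Local Open Scope classical_set_scope.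
Local Open Scope ring_scope.

(** * Real and complex scalars *)

(** The space carries no sigma-algebra and nothing is integrated on it. Sign averages are a finite
    recursion, and [w |-> N(sum_j xi_j(w) x_j)^2] is integrable as a dominated limit of functions
    with finitely many values. The geometry sees the [xi_j] only through the four properties in
    [random_moment], and works with real scalars through [realified]; complex scalars return once a
    quadratic form is at hand.

    A Lipschitz map can be prescribed freely only on separated points, and failure of type 2
    provides them: a large ratio [B / W] makes the variance of the norm of a sign sum, at most [W],
    negligible against its squared mean. Each of finitely many unwanted events then has small
    probability, and all are avoided at once.

    Hahn-Banach needs to know that no identity between multisets produces a negative bound for [0].
    Such an identity leaves a common remainder on both sides of a domination. Iterating the
    domination many times carries that remainder along once, so it disappears in the limit, and the
    loss stays [C T] however many rotations are used. *)

Section Scalars.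
Context (R : realType) (s : scalars).
Local Notation K := (scalar_field R s).

Lemma of_realD (a b : R) : of_real s (a + b) = of_real s a + of_real s b :> K.
Proof. by case: s => //=; rewrite rmorphD. Qed.

Lemma of_realM (a b : R) : of_real s (a * b) = of_real s a * of_real s b :> K.
Proof. by case: s => //=; rewrite rmorphM. Qed.

Lemma of_real0 : of_real s (0 : R) = 0 :> K.
Proof. by case: s. Qed.

Lemma of_real1 : of_real s (1 : R) = 1 :> K.
Proof. by case: s. Qed.

Lemma of_real_le (a b : R) : ((of_real s a : K) <= of_real s b) = (a <= b).
Proof. by case: s => //=; rewrite lecR. Qed.

Lemma of_real_lt (a b : R) : ((of_real s a : K) < of_real s b) = (a < b).
Proof. by case: s => //=; rewrite ltcR. Qed.

Lemma of_real_inj : injective (of_real s : R -> K).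
Proof. by move=> a b /eqP; rewrite eq_le !of_real_le -eq_le => /eqP. Qed.

Lemma scalar_reK (k : K) : 0 <= k -> of_real s (scalar_re k) = k.
Proof.
case: s k => //= -[a b]; rewrite lecE /= => /andP[/eqP b0 _].
by rewrite b0.
Qed.

Lemma of_real_norm (a : R) : `|of_real s a : K| = of_real s `|a|.
Proof. by case: s => //=; rewrite normc_def /= expr0n addr0 sqrtr_sqr. Qed.

Lemma of_realX (a : R) n : of_real s (a ^+ n) = of_real s a ^+ n :> K.
Proof. by elim: n => [|n IH]; rewrite ?of_real1 // !exprS of_realM IH. Qed.

(** A synonym on which the reals act through [of_real], so that arguments over a real module apply
    to complex spaces too. *)
Definition realified (X : normedModType K) : Type := X.

HB.instance Definition _ (X : normedModType K) :=
  GRing.Zmodule.on (realified X).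

Section RealifiedModule.
Variable X : normedModType K.

Definition rscale (a : R) (x : realified X) : realified X :=
  (of_real s a : K) *: (x : X).

Fact rscaleA a b x : rscale a (rscale b x) = rscale (a * b) x.
Proof. by rewrite /rscale scalerA of_realM. Qed.

Fact rscale1 : left_id 1 rscale.
Proof. by move=> x; rewrite /rscale of_real1 scale1r. Qed.

Fact rscaleDr : right_distributive rscale +%R.
Proof. by move=> a x y; rewrite /rscale scalerDr. Qed.

Fact rscaleDl x : {morph rscale^~ x : a b / a + b}.
Proof. by move=> a b; rewrite /rscale of_realD scalerDl. Qed.

HB.instance Definition _ := GRing.Zmodule_isLmodule.Build R (realified X)
  rscaleA rscale1 rscaleDr rscaleDl.

End RealifiedModule.

Section Rnorm.
Variable X : normedModType K.
Implicit Types x y : X.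

Lemma of_real_rnorm x : of_real s (rnorm x) = `|x|.
Proof. by rewrite /rnorm scalar_reK. Qed.

Lemma rnorm_ge0 x : 0 <= rnorm x.
Proof. by rewrite -of_real_le of_real_rnorm of_real0. Qed.

Lemma ler_rnormD x y : rnorm (x + y) <= rnorm x + rnorm y.
Proof. by rewrite -of_real_le of_realD !of_real_rnorm ler_normD. Qed.

Lemma rnormZ (a : R) x : rnorm (of_real s a *: x) = `|a| * rnorm x.
Proof.
by apply: of_real_inj; rewrite of_realM !of_real_rnorm normrZ of_real_norm.
Qed.

Lemma rnorm_eq0 x : rnorm x = 0 -> x = 0.
Proof.
by move=> x0; apply/eqP; rewrite -normr_eq0 -of_real_rnorm x0 of_real0.
Qed.

End Rnorm.

Lemma of_real_lipschitz (X Y : normedModType K) (f : X -> Y) (L : R) :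
  (of_real s L).-lipschitz f <->
  forall x y, rnorm (f x - f y) <= L * rnorm (x - y).
Proof.
split=> [lipf x y|lipf].
  have /= := lipf (x, y) (conj I I).
  by rewrite -!of_real_rnorm -of_realM of_real_le.
move=> [x y] _ /=.
by rewrite -!of_real_rnorm -of_realM of_real_le.
Qed.

End Scalars.

(** * Averages over signs *)

Section SignAverage.
Context (R : realType).

(* The mean of [g (z +- s_1 +- ... +- s_n)] over all choices of signs. *)
Fixpoint signavg (V : lmodType R) (g : V -> R) (s : seq V) (z : V) : R :=
  if s is a :: s' then (signavg g s' (z + a) + signavg g s' (z - a)) / 2
  else g z.

Definition parallelogram (V : lmodType R) (q : V -> R) : Prop :=
  forall x y, q (x + y) + q (x - y) = 2 * q x + 2 * q y.

Definition convexfun (V : lmodType R) (g : V -> R) : Prop :=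
  forall (t : R) u v, 0 <= t <= 1 ->
    g (t *: u + (1 - t) *: v) <= t * g u + (1 - t) * g v.

Section OneSpace.
Variable V : lmodType R.
Implicit Types (g h : V -> R) (s t : seq V).

Lemma eq_signavg g h s z : g =1 h -> signavg g s z = signavg h s z.
Proof. by move=> gh; elim: s z => [|a s IH] z /=; rewrite ?IH. Qed.

Lemma signavgD g h s z :
  signavg (fun v => g v + h v) s z = signavg g s z + signavg h s z.
Proof. by elim: s z => [|a s IH] z //=; rewrite !IH; ring. Qed.

Lemma signavgZ c g s z : signavg (fun v => c * g v) s z = c * signavg g s z.
Proof. by elim: s z => [|a s IH] z //=; rewrite !IH; ring. Qed.

Lemma signavg_cst c s z : signavg (fun=> c : R) s z = c.
Proof. by elim: s z => [|a s IH] z //=; rewrite !IH; field. Qed.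

Lemma signavg_sum (I : Type) (r : seq I) (P : pred I) (g : I -> V -> R) s z :
  signavg (fun v => \sum_(i <- r | P i) g i v) s z =
  \sum_(i <- r | P i) signavg (g i) s z.
Proof.
elim: r => [|i r IH].
  by rewrite big_nil -[RHS](signavg_cst 0 s z); apply: eq_signavg => v; rewrite big_nil.
rewrite big_cons -IH; case: ifP => Pi.
  by rewrite -signavgD; apply: eq_signavg => v; rewrite big_cons Pi.
by apply: eq_signavg => v; rewrite big_cons Pi.
Qed.

Lemma le_signavg g h s z :
  (forall v, g v <= h v) -> signavg g s z <= signavg h s z.
Proof.
by move=> gh; elim: s z => [|a s IH] z //=; rewrite ler_pM2r ?invr_gt0// lerD.
Qed.

Lemma signavg_ge0 g s z : (forall v, 0 <= g v) -> 0 <= signavg g s z.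
Proof.
by move=> g0; rewrite -(signavg_cst 0 s z); apply: le_signavg.
Qed.

Lemma signavg_gt_ex g s z c : signavg g s z < c -> exists v, g v < c.
Proof.
apply: contraPP => /forallNP H; apply/negP; rewrite -leNgt.
rewrite -(signavg_cst c s z); apply: le_signavg => v.
by rewrite leNgt; apply/negP/H.
Qed.

Lemma signavg_cat g s t z : signavg g (s ++ t) z = signavg (signavg g t) s z.
Proof. by elim: s z => [|a s IH] z //=; rewrite !IH. Qed.

Lemma signavg_shift g s z y :
  signavg g s (z + y) = signavg (fun v => g (v + y)) s z.
Proof.
elim: s z => [|a s IH] z //=.
by rewrite addrAC IH (addrAC z y) IH.
Qed.

Lemma signavg_swap g s t z :
  signavg (signavg g t) s z = signavg (signavg g s) t z.
Proof.
elim: s g z => [|a s IH] g z; first exact: eq_signavg.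
rewrite /= !IH !signavg_shift -signavgD mulrC -signavgZ.
by apply: eq_signavg => v /=; rewrite mulrC.
Qed.

(** Averages over different signs commute, and exchanges of neighbouring blocks generate all
    permutations. *)
Lemma signavg_perm g s t z : perm_eq s t -> signavg g s z = signavg g t z.
Proof.
move: s t; apply: catCA_perm_subst => s1 s2 s3.
rewrite !signavg_cat (eq_signavg _ _ (signavg_cat g s2 s3)).
by rewrite (eq_signavg _ _ (signavg_cat g s1 s3)) signavg_swap.
Qed.

Lemma convexfun_midpoint g u v :
  convexfun g -> 2 * g u <= g (u + v) + g (u - v).
Proof.
have h : 0 <= (2^-1 : R) <= 1 by apply/andP; split; lra.
move=> gc; have := gc _ (u + v) (u - v) h.
have -> : 1 - 2^-1 = 2^-1 :> R by field.
have h2 : 2^-1 + 2^-1 = 1 :> R by field.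
have -> : 2^-1 *: (u + v) + 2^-1 *: (u - v) = u.
  by rewrite -scalerDr addrACA subrr addr0 scalerDr -scalerDl h2 scale1r.
lra.
Qed.

Lemma convexfun_signavg g s : convexfun g -> convexfun (signavg g s).
Proof.
move=> gc; elim: s => [|a s IH] //= t u v t01.
have E w : t *: u + (1 - t) *: v + w = t *: (u + w) + (1 - t) *: (v + w).
  by rewrite !scalerDr addrACA -scalerDl subrKC scale1r.
have := IH t (u + a) (v + a) t01; have := IH t (u - a) (v - a) t01.
rewrite -!E => h1 h2; lra.
Qed.

Lemma signavg_ge g s z : convexfun g -> g z <= signavg g s z.
Proof.
move=> gc; elim: s z => [|a s IH] z //=.
have := convexfun_midpoint z a gc; have := IH (z + a); have := IH (z - a); lra.
Qed.

(** Both points on the left lie between [z - e x] and [z + e x], with opposite weights [t] and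
    [1 - t]; in the sum of the two convexity inequalities the weights disappear. *)
Lemma convexfun_contract g (c e : R) x z : convexfun g -> `|c| <= e ->
  g (z + c *: x) + g (z - c *: x) <= g (z + e *: x) + g (z - e *: x).
Proof.
move=> gc; rewrite ler_norml => /andP[c1 c2].
have [e0|e0] := eqVneq e 0; first by have -> : c = e by lra.
have ep : 0 < e by lra.
pose t := (c + e) / (2 * e).
have t01 : 0 <= t <= 1.
  by rewrite divr_ge0 ?ler_pdivrMr/=; lra.
have t01' : 0 <= 1 - t <= 1 by lra.
have := gc t (z + e *: x) (z - e *: x) t01.
have := gc (1 - t) (z + e *: x) (z - e *: x) t01'.
have E r : r *: (z + e *: x) + (1 - r) *: (z - e *: x) = z + ((2 * r - 1) * e) *: x.
  rewrite !scalerDr addrACA -scalerDl subrKC scale1r; congr (_ + _).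
  by rewrite scalerN -scaleNr !scalerA -scalerDl; congr (_ *: _); ring.
rewrite !E.
have -> : (2 * t - 1) * e = c by rewrite /t; field; lra.
have -> : (2 * (1 - t) - 1) * e = - c by rewrite /t; field; lra.
rewrite scaleNr; lra.
Qed.

(** The contraction principle: the tail is enlarged by induction, then the head coefficient, using
    that the average over the tail is still convex. *)
Lemma signavg_contract (I : Type) (r : seq I) (c e : I -> R) (x : I -> V) g z :
  convexfun g -> (forall i, `|c i| <= e i) ->
  signavg g [seq c i *: x i | i <- r] z <= signavg g [seq e i *: x i | i <- r] z.
Proof.
move=> gc ce; elim: r z => [|i r IH] z //=.
apply: (@le_trans _ _ ((signavg g [seq e i *: x i | i <- r] (z + c i *: x i) +
   signavg g [seq e i *: x i | i <- r] (z - c i *: x i)) / 2)).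
  by rewrite ler_pM2r// lerD.
rewrite ler_pM2r//; apply: convexfun_contract => //; exact: convexfun_signavg.
Qed.

Lemma signavg_parallelogram q s z : parallelogram q ->
  signavg q s z = q z + \sum_(a <- s) q a.
Proof.
move=> qp; elim: s z => [|a s IH] z /=; first by rewrite big_nil addr0.
by rewrite !IH big_cons; have := qp z a; lra.
Qed.

End OneSpace.

Lemma signavg_map (V W : lmodType R) (L : {linear V -> W}) (g : W -> R) s z :
  signavg g (map L s) (L z) = signavg (g \o L) s z.
Proof. by elim: s z => [|a s IH] z //=; rewrite -linearB -linearD !IH. Qed.

Record seminorm (V : lmodType R) (N : V -> R) : Prop := Seminorm {
  seminormD : forall x y, N (x + y) <= N x + N y;
  seminormZ : forall (a : R) x, N (a *: x) = `|a| * N x }.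

Definition signmoment (V : lmodType R) (N : V -> R) (s : seq V) : R :=
  signavg (fun v => N v ^+ 2) s 0.

Definition sqsum (V : lmodType R) (N : V -> R) (s : seq V) : R :=
  \sum_(a <- s) N a ^+ 2.

Section Seminorm.
Variables (V : lmodType R) (N : V -> R).
Hypothesis HN : seminorm N.
Local Notation B := (signmoment N).
Local Notation W := (sqsum N).

Lemma seminorm0 : N 0 = 0.
Proof. by rewrite -(scale0r 0) (seminormZ HN) normr0 mul0r. Qed.

Lemma seminormN x : N (- x) = N x.
Proof. by rewrite -scaleN1r (seminormZ HN) normrN1 mul1r. Qed.

Lemma seminorm_ge0 x : 0 <= N x.
Proof. by have := seminormD HN x (- x); rewrite subrr seminorm0 seminormN; lra. Qed.

Lemma seminormB_le x y : `|N x - N y| <= N (x - y).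
Proof.
have e : N (y - x) = N (x - y) by rewrite -opprB seminormN.
rewrite ler_norml; apply/andP; split.
  by have := seminormD HN (y - x) x; rewrite subrK e; lra.
by have := seminormD HN (x - y) y; rewrite subrK; lra.
Qed.

Lemma convexfun_seminorm : convexfun N.
Proof.
move=> t u v /andP[t0 t1]; rewrite (le_trans (seminormD HN _ _))//.
by rewrite !(seminormZ HN) !ger0_norm// subr_ge0.
Qed.

Lemma convexfun_seminorm_sqr : convexfun (fun v => N v ^+ 2).
Proof.
move=> t u v t01; have := convexfun_seminorm u v t01; move: t01 => /andP[t0 t1] h.
apply: (@le_trans _ _ ((t * N u + (1 - t) * N v) ^+ 2)).
  by rewrite ler_sqr ?nnegrE ?seminorm_ge0// addr_ge0// mulr_ge0 ?seminorm_ge0// subr_ge0.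
rewrite -subr_ge0.
have -> : t * N u ^+ 2 + (1 - t) * N v ^+ 2 - (t * N u + (1 - t) * N v) ^+ 2 =
  t * (1 - t) * (N u - N v) ^+ 2 by ring.
by rewrite mulr_ge0 ?sqr_ge0// mulr_ge0// subr_ge0.
Qed.

Lemma seminorm_sum (I : Type) (r : seq I) (F : I -> V) :
  N (\sum_(j <- r) F j) <= \sum_(j <- r) N (F j).
Proof.
elim/big_ind2: _ => [|u a v b ua vb|//]; first by rewrite seminorm0.
by apply: le_trans (seminormD HN _ _) _; apply: lerD.
Qed.

(** The right side exceeds [(N(x) + N(y))^2] by [(d N(x) - N(y))^2 / d]. A small [d] keeps the
    factor of the main term near 1, as [dominated] requires. *)
Lemma seminorm_sqrD d x y : 0 < d ->
  N (x + y) ^+ 2 <= (1 + d) * N x ^+ 2 + (1 + d^-1) * N y ^+ 2.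
Proof.
move=> d0; apply: (@le_trans _ _ ((N x + N y) ^+ 2)).
  by rewrite ler_sqr ?nnegrE ?seminorm_ge0 ?addr_ge0 ?seminorm_ge0// (seminormD HN).
rewrite -subr_ge0.
have -> : (1 + d) * N x ^+ 2 + (1 + d^-1) * N y ^+ 2 - (N x + N y) ^+ 2 =
  d^-1 * (d * N x - N y) ^+ 2 by field; lra.
by rewrite mulr_ge0 ?sqr_ge0// invr_ge0 ltW.
Qed.

Lemma sqsum_ge0 s : 0 <= W s.
Proof. by apply: sumr_ge0 => *; apply: sqr_ge0. Qed.

Lemma signmoment_ge0 s : 0 <= B s.
Proof. by apply: signavg_ge0 => *; apply: sqr_ge0. Qed.

Lemma sqsum_cat s t : W (s ++ t) = W s + W t.
Proof. by rewrite /sqsum big_cat. Qed.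

Lemma signmoment_perm s t : perm_eq s t -> B s = B t.
Proof. exact: signavg_perm. Qed.

Lemma sqsumZ c s : W [seq c *: x | x <- s] = c ^+ 2 * W s.
Proof.
rewrite /sqsum big_map mulr_sumr; apply: eq_bigr => x _.
by rewrite (seminormZ HN) exprMn real_normK ?num_real.
Qed.

Lemma signavg_sqrZ c s z :
  signavg (fun v => N v ^+ 2) [seq c *: x | x <- s] (c *: z) =
  c ^+ 2 * signavg (fun v => N v ^+ 2) s z.
Proof.
rewrite -signavgZ; elim: s z => [|a s IH] z /=.
  by rewrite (seminormZ HN) exprMn real_normK ?num_real.
by rewrite -scalerBr -scalerDr !IH.
Qed.

Lemma signmomentZ c s : B [seq c *: x | x <- s] = c ^+ 2 * B s.
Proof. by rewrite /signmoment -signavg_sqrZ scaler0. Qed.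

Lemma signavg_seminormZ c s :
  signavg N [seq c *: x | x <- s] 0 = `|c| * signavg N s 0.
Proof.
rewrite -signavgZ -[X in signavg _ _ X = _](scaler0 _ c).
elim: s (0 : V) => [|a s IH] z /=; first by rewrite (seminormZ HN).
by rewrite -scalerBr -scalerDr !IH.
Qed.

Lemma signavg_sqrD (I : Type) (r : seq I) (x y : I -> V) d z w : 0 < d ->
  signavg (fun v => N v ^+ 2) [seq x i + y i | i <- r] (z + w) <=
  (1 + d) * signavg (fun v => N v ^+ 2) [seq x i | i <- r] z +
  (1 + d^-1) * signavg (fun v => N v ^+ 2) [seq y i | i <- r] w.
Proof.
move=> d0; elim: r z w => [|i r IH] z w /=; first exact: seminorm_sqrD.
have := IH (z + x i) (w + y i); have := IH (z - x i) (w - y i).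
rewrite (addrACA z w) opprD (addrACA z w) => h1 h2.
apply: (@le_trans _ _ ((((1 + d) * signavg (fun v : V => N v ^+ 2) [seq x i | i <- r] (z + x i) +
     (1 + d^-1) * signavg (fun v : V => N v ^+ 2) [seq y i | i <- r] (w + y i)) +
  ((1 + d) * signavg (fun v : V => N v ^+ 2) [seq x i | i <- r] (z - x i) +
     (1 + d^-1) * signavg (fun v : V => N v ^+ 2) [seq y i | i <- r] (w - y i))) / 2)).
  by rewrite ler_pM2r// lerD.
by rewrite le_eqVlt; apply/orP; left; apply/eqP; field; lra.
Qed.

Lemma signmoment_mapD (I : Type) (r : seq I) (x y : I -> V) :
  B [seq x i + y i | i <- r] <= 2 * B [seq x i | i <- r] + 2 * B [seq y i | i <- r].
Proof.
have := @signavg_sqrD I r x y 1 0 0 ltr01; rewrite addr0 invr1.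
by have -> : 1 + 1 = 2 :> R by [].
Qed.

Lemma signmoment_cat_le s t d : 0 < d ->
  B (s ++ t) <= (1 + d) * B s + (1 + d^-1) * B t.
Proof.
move=> d0; rewrite /signmoment signavg_cat.
apply: (@le_trans _ _ (signavg (fun v => (1 + d) * N v ^+ 2 + (1 + d^-1) * B t) s 0)).
  apply: le_signavg => v; rewrite -[v in leLHS]add0r signavg_shift /signmoment.
  apply: (@le_trans _ _ (signavg (fun w =>
      (1 + d) * N v ^+ 2 + (1 + d^-1) * N w ^+ 2) t 0)).
    by apply: le_signavg => w; rewrite (addrC w); apply: seminorm_sqrD.
  by rewrite signavgD signavg_cst signavgZ.
by rewrite signavgD signavgZ signavg_cst.
Qed.

Lemma signmoment_cat_ge s t : B s <= B (s ++ t).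
Proof.
rewrite /signmoment signavg_cat; apply: le_signavg => v.
exact/(@signavg_ge _ (fun v => N v ^+ 2))/convexfun_seminorm_sqr.
Qed.

Lemma signmoment_contract (I : Type) (r : seq I) (c e : I -> R) (x : I -> V) :
  (forall i, `|c i| <= e i) ->
  B [seq c i *: x i | i <- r] <= B [seq e i *: x i | i <- r].
Proof. exact/signavg_contract/convexfun_seminorm_sqr. Qed.

Lemma signavg_seminorm_lip s z w : signavg N s z - signavg N s w <= N (z - w).
Proof.
elim: s z w => [|a s IH] z w /=.
  by rewrite (le_trans (ler_norm _))// seminormB_le.
have := IH (z + a) (w + a); have := IH (z - a) (w - a).
have -> : z + a - (w + a) = z - w by rewrite opprD addrACA subrr addr0.
have -> : z - a - (w - a) = z - w by rewrite opprD addrACA subrr addr0.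
lra.
Qed.

(* Efron-Stein: [N] is Lipschitz in each sign. *)
Lemma signavg_sqr_variance s z :
  signavg (fun v => N v ^+ 2) s z <= signavg N s z ^+ 2 + W s.
Proof.
elim: s z => [|a s IH] z /=; first by rewrite /sqsum big_nil addr0.
rewrite /sqsum big_cons -/(W s).
have h1 := IH (z + a); have h2 := IH (z - a).
have d1 := signavg_seminorm_lip s (z + a) (z - a).
have d2 := signavg_seminorm_lip s (z - a) (z + a).
(* Flipping the sign of [a] moves the base point by [2 a], so half the difference of the two
   conditional means is at most [N a]. *)
have E1 : z + a - (z - a) = 2 *: a.
  by rewrite opprB addrC addrA subrK scaler_nat mulr2n.
have E2 : z - a - (z + a) = (- 2) *: a by rewrite -[LHS]opprB E1 scaleNr.
rewrite E1 E2 !(seminormZ HN) normrN ger0_norm// in d1 d2.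
set p := signavg N s (z + a) in h1 d1 d2 *; set m := signavg N s (z - a) in h2 d1 d2 *.
have h3 : ((p - m) / 2) ^+ 2 <= N a ^+ 2.
  rewrite -[leRHS]real_normK ?num_real// -[leLHS]real_normK ?num_real//.
  rewrite ler_sqr ?nnegrE// (ger0_norm (seminorm_ge0 a)) ler_norml; lra.
apply: (@le_trans _ _ ((p ^+ 2 + W s + (m ^+ 2 + W s)) / 2)).
  by rewrite ler_pM2r// lerD.
have -> : (p ^+ 2 + W s + (m ^+ 2 + W s)) / 2 =
  ((p + m) / 2) ^+ 2 + ((p - m) / 2) ^+ 2 + W s by field.
by rewrite addrA lerD2r lerD2l.
Qed.

(** Chebyshev's inequality for the lower tail: where [N v < a / 2], the deviation from the mean
    exceeds [a / 2], and the variance is at most [W s]. *)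
Lemma signavg_chebyshev s (a : R) : 0 <= a -> a <= signavg N s 0 ->
  signavg (fun v => (N v < a / 2)%R%:R) s 0 * (a ^+ 2 / 4) <= W s.
Proof.
set A := signavg N s 0 => a0 aA.
rewrite mulrC -signavgZ.
apply: (@le_trans _ _ (signavg (fun v => N v ^+ 2 + (- (2 * A)) * N v + A ^+ 2) s 0)).
  apply: le_signavg => v.
  have -> : N v ^+ 2 + (- (2 * A)) * N v + A ^+ 2 = (A - N v) ^+ 2 by ring.
  case: (ltP (N v) (a / 2)) => h /=; last by rewrite mulr0 sqr_ge0.
  rewrite mulr1 (_ : a ^+ 2 / 4 = (a / 2) ^+ 2); last by field.
  by rewrite ler_sqr ?nnegrE; lra.
rewrite !signavgD signavgZ signavg_cst -/A.
by have := signavg_sqr_variance s 0; rewrite -/A; lra.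
Qed.

End Seminorm.
End SignAverage.


(** * Rademacher type and cotype from Lipschitz maps *)

Section Extremal.
Context (R : realType) (V : lmodType R) (N : V -> R).
Hypothesis HN : seminorm N.
Local Notation B := (signmoment N).
Local Notation W := (sqsum N).
Local Notation A := (fun s => signavg N s 0).

(** Its sign sum is [sum_c c Y_c] with independent copies [Y_c] of the sign sum of [s]. *)
Definition blocks (cs : seq R) (s : seq V) : seq V :=
  [seq c *: v | c <- cs, v <- s].

Definition sumsq (cs : seq R) : R := \sum_(c <- cs) c ^+ 2.

Lemma sumsq_ge0 cs : 0 <= sumsq cs.
Proof. by apply: sumr_ge0 => *; apply: sqr_ge0. Qed.

Lemma blocks_blocks ds cs s :
  blocks ds (blocks cs s) = blocks [seq d * c | d <- ds, c <- cs] s.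
Proof.
rewrite /blocks; elim: ds => //= d ds ->; rewrite allpairs_cat; congr (_ ++ _).
rewrite map_allpairs allpairs_mapl.
by apply: eq_allpairs => c v; rewrite scalerA.
Qed.

Lemma sumsq_allpairs ds cs :
  sumsq [seq d * c | d <- ds, c <- cs] = sumsq ds * sumsq cs.
Proof.
rewrite /sumsq big_allpairs_dep mulr_suml; apply: eq_bigr => d _.
by rewrite mulr_sumr; apply: eq_bigr => c _; rewrite exprMn.
Qed.

Lemma sqsum_blocks cs s : W (blocks cs s) = sumsq cs * W s.
Proof.
rewrite /sqsum big_allpairs_dep mulr_suml; apply: eq_bigr => c _.
rewrite mulr_sumr; apply: eq_bigr => v _.
by rewrite (seminormZ HN) exprMn real_normK ?num_real.
Qed.

(** On a line the squared seminorm is a multiple of [t^2], which satisfies the parallelogram law, so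
    mixed terms average out. *)
Lemma signmoment_line cs v : B [seq c *: v | c <- cs] = sumsq cs * N v ^+ 2.
Proof.
have q : parallelogram (fun t : R^o => t ^+ 2) by move=> x y; ring.
have L : linear (fun t : R^o => t *: v).
  by move=> a x y /=; rewrite scalerDl scalerA.
pose f := GRing.isLinear.Build R R^o V _ (fun t : R^o => t *: v) L.
pose F : {linear R^o -> V} := HB.pack (fun t : R^o => t *: v) f.
rewrite /signmoment -[X in signavg _ _ X](linear0 F).
rewrite (_ : [seq c *: v | c <- cs] = map F cs)// signavg_map.
under eq_signavg => t do
  rewrite /= (seminormZ HN) exprMn real_normK ?num_real// mulrC.
rewrite signavgZ (signavg_parallelogram _ _ q) expr0n add0r mulrC.
by congr (_ * _).
Qed.

(** The bound depends on [s]; its purpose is to make the supremum in [near_extremal] finite. Each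
    vector of [s] contributes a line, and adding a line costs a factor 2. *)
Lemma signmoment_blocks_bound s :
  exists2 K, 0 <= K & forall cs, B (blocks cs s) <= K * sumsq cs.
Proof.
elim: s => [|v s [K K0 IH]].
  exists 0 => // cs; rewrite mul0r /blocks.
  rewrite (_ : [seq _ | _ <- _, _ <- _] = [::]); last by elim: cs.
  by rewrite /signmoment /= (seminorm0 HN) expr0n.
exists (2 * N v ^+ 2 + 2 * K) => [|cs].
  by rewrite addr_ge0// mulr_ge0// sqr_ge0.
have p : perm_eq (blocks cs (v :: s)) ([seq c *: v | c <- cs] ++ blocks cs s).
  by rewrite /blocks perm_allpairs_consr.
rewrite (signmoment_perm _ p).
have := signmoment_cat_le HN [seq c *: v | c <- cs] (blocks cs s) ltr01.
rewrite signmoment_line invr1; have := IH cs.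
have -> : (1 + 1 : R) = 2 by [].
lra.
Qed.

(* If type 2 fails for [w], maximise [B (blocks cs w) / sumsq cs] over [cs]:
   a near-maximiser still violates type 2 badly, so its sign sums concentrate,
   but it is almost optimal among its own blocks. *)
Lemma near_extremal (eta : R) : 0 < eta -> (forall C, exists s, C * W s < B s) ->
  exists s, [/\ A s = 1, W s <= eta &
    forall cs, B (blocks cs s) <= 4 * sumsq cs].
Proof.
move=> eta0 notype.
(* [C >= 4] makes [W s] at most half of [B s], whence [B s <= 2 * A s ^+ 2]; [C * eta >= 4] then
   turns [C * W s <= 4 * A s ^+ 2] into the bound [eta] after normalisation. *)
pose C := 4 + 4 / eta.
have C4 : 4 <= C by rewrite lerDl divr_ge0// ltW.
have Ce : 4 <= C * eta by rewrite /C mulrDl divfK ?gt_eqF//; nra.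
have [w Cw] := notype C.
have [K K0 HK] := signmoment_blocks_bound w.
pose E := [set B (blocks cs w) / sumsq cs | cs in [set cs | 0 < sumsq cs]].
have W0 s : 0 <= W s by apply: sqsum_ge0.
have E1 : sumsq [:: 1] = 1 by rewrite /sumsq big_seq1 expr1n.
have B1 : blocks [:: 1] w = w.
  by rewrite /blocks /= cats0; under eq_map => v do rewrite scale1r; rewrite map_id.
have Ew : E (B w) by exists [:: 1]; rewrite /= ?B1 E1 ?divr1.
have Eub : has_sup E.
  split; first by exists (B w).
  by exists K => _ [cs /= c0 <-]; rewrite ler_pdivrMr.
pose tau := sup E.
have tau_ub cs : B (blocks cs w) <= tau * sumsq cs.
  have [c0|] := ltP 0 (sumsq cs).
    rewrite -ler_pdivrMr//; apply: ub_le_sup => //; first by case: Eub.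
    by exists cs.
  move=> c0; have c00 : sumsq cs = 0 by apply/eqP; rewrite eq_le c0 sumsq_ge0.
  by have := HK cs; rewrite c00 !mulr0.
have Bw0 : 0 < B w by apply: le_lt_trans Cw; rewrite mulr_ge0//; lra.
have tau_w : B w <= tau by have := tau_ub [:: 1]; rewrite B1 E1 mulr1.
have tau0 : 0 < tau by lra.
(* A family within a factor 2 of the supremum; this 2 and the one in [B s <= 2 * A s ^+ 2] make up
   the 4 of the statement. *)
have [_ [cs /= cs0 <-]] := sup_adherent (divr_gt0 tau0 (ltr0Sn R 1)) Eub.
rewrite -/tau (_ : tau - tau / 2 = tau / 2); last by field.
rewrite ltr_pdivlMr// => Hcs.
pose s := blocks cs w.
have Ws : W s = sumsq cs * W w by exact: sqsum_blocks.
have Bs0 : 0 < B s.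
  by apply: le_lt_trans Hcs; rewrite mulr_ge0 ?sumsq_ge0//; lra.
have CWs : C * W s <= 2 * B s.
  rewrite Ws mulrCA.
  have : sumsq cs * (C * W w) <= sumsq cs * B w by rewrite ler_pM2l// ltW.
  have : sumsq cs * B w <= sumsq cs * tau by rewrite ler_pM2l.
  by rewrite -/s in Hcs *; nra.
have HA : B s <= A s ^+ 2 + W s by apply: signavg_sqr_variance.
have A0 : 0 <= A s by apply: signavg_ge0; exact: seminorm_ge0.
have AB : B s <= 2 * A s ^+ 2 by have := W0 s; nra.
have Ap : 0 < A s by rewrite lt_neqAle A0 andbT eq_sym; apply/eqP => A00; nra.
have Ai : (A s)^-1 * A s = 1 by rewrite mulVf// gt_eqF.
have A2i : (A s)^-1 ^+ 2 * A s ^+ 2 = 1 by rewrite -exprMn Ai expr1n.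
have Ai0 : 0 < (A s)^-1 ^+ 2 by rewrite exprn_gt0// invr_gt0.
exists [seq (A s)^-1 *: v | v <- s]; split.
- by rewrite (signavg_seminormZ HN) ger0_norm ?invr_ge0.
- rewrite (sqsumZ HN); move: (W s) (W0 s) CWs AB A2i Ai0 => x.
  move: (B s) (A s ^+ 2) ((A s)^-1 ^+ 2) => b a i x0 h1 h2 h3 h4.
  have h5 : C * x <= 4 * a by lra.
  have h6 : i * (C * x) <= 4 by rewrite (le_trans (ler_wpM2l (ltW h4) h5))// mulrCA h3 mulr1.
  rewrite -(ler_pM2l (_ : 0 < C)); last by lra.
  by rewrite mulrCA; apply: le_trans h6 _.
(* Blocks of blocks of [w] are again blocks of [w], so [tau] bounds them as well, with the
   coefficient sums multiplied. *)
- move=> ds.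
  have -> : [seq (A s)^-1 *: v | v <- s] = blocks [:: (A s)^-1] s.
    by rewrite /blocks /= cats0.
  rewrite /s !blocks_blocks (le_trans (tau_ub _))// !sumsq_allpairs -/s.
  have -> : sumsq [:: (A s)^-1] = (A s)^-1 ^+ 2 by rewrite /sumsq big_seq1.
  rewrite -/s in Hcs; have h1 : tau * sumsq cs <= 4 * A s ^+ 2 by lra.
  rewrite [leLHS](_ : _ = sumsq ds * ((A s)^-1 ^+ 2 * (tau * sumsq cs))); last by ring.
  rewrite (mulrC 4) ler_wpM2l ?sumsq_ge0//.
  by rewrite (le_trans (ler_wpM2l (ltW Ai0) h1))// mulrCA A2i mulr1.
Qed.

End Extremal.

Section RandomMoment.
Context (R : realType) (V : lmodType R) (N : V -> R).

Definition lincomb n (c : 'I_n -> R) (y : ('I_n -> V)) : V :=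
  \sum_j c j *: y j.

(* The properties of [M n x = E N(sum_j xi_j x_j)^2] that the passage from
   Lipschitz maps to Rademacher type and cotype relies on; [k] stands for
   [(E|xi|)^2] and [m] for [E|xi|^4]. *)
Record random_moment (k m : R) (M : forall n, ('I_n -> V) -> R) : Prop := {
  random_moment_ge : forall n (x : 'I_n -> V),
    k * signmoment N [seq x j | j <- enum 'I_n] <= M n x;
  random_moment_line : forall n (t : 'I_n -> R) (w : V),
    M n (fun j => t j *: w) = (\sum_j t j ^+ 2) * N w ^+ 2;
  random_moment_truncate : forall n (x : 'I_n -> V) (C A : R),
    0 <= C -> 0 < A ->
    (forall c : 'I_n -> R, signmoment N [seq c j *: x j | j <- enum 'I_n] <=
       C * \sum_j c j ^+ 2 * N (x j) ^+ 2) ->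
    M n x <= 2 * A ^+ 2 * signmoment N [seq x j | j <- enum 'I_n] +
             2 * C * (m / A ^+ 2) * \sum_j N (x j) ^+ 2;
  random_moment_signavg : forall n (s : seq ('I_n -> V)) (a : 'I_n -> R) (C : R),
    0 <= C ->
    (forall c : 'I_n -> R, signavg (fun y => N (lincomb c y) ^+ 2) s 0 <=
       C * \sum_j (c j * a j) ^+ 2) ->
    signavg (fun y => M n y) s 0 <= C * \sum_j a j ^+ 2 }.

End RandomMoment.

(** * Separated realisations of random sign sums *)

Section SeparatedPoints.
Context (R : realType) (V : lmodType R) (N : V -> R).
Hypothesis HN : seminorm N.
Local Notation W := (sqsum N).

Lemma lincomb_linear n (c : 'I_n -> R) : linear (lincomb (V := V) c).
Proof.
move=> a x y; rewrite /lincomb scaler_sumr -big_split; apply: eq_bigr => j _ /=.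
by rewrite scalerDr !scalerA mulrC.
Qed.

HB.instance Definition _ n (c : 'I_n -> R) :=
  GRing.isLinear.Build R ('I_n -> V) V _ (lincomb c) (lincomb_linear c).

Definition single n (j : 'I_n) (v : V) : ('I_n -> V) :=
  fun i => if i == j then v else 0.

(** A sign sum of this family is a tuple whose [j]-th entry is [a j] times an independent copy of
    the sign sum of [s]; [lincomb c] maps the family to [blocks (coefs c a) s]. *)
Definition flat_list n (a : 'I_n -> R) (s : seq V) : seq ('I_n -> V) :=
  [seq single j (a j *: v) | j <- enum 'I_n, v <- s].

Definition coefs n (c a : 'I_n -> R) : seq R := [seq c j * a j | j <- enum 'I_n].

Lemma lincomb_single n (c : 'I_n -> R) j v : lincomb c (single j v) = c j *: v.
Proof.
rewrite /lincomb (bigD1 j)//= /single eqxx big1 ?addr0// => i /negPf ij.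
by rewrite ij scaler0.
Qed.

Lemma map_lincomb_flat n (c a : 'I_n -> R) s :
  map (lincomb c) (flat_list a s) = blocks (coefs c a) s.
Proof.
rewrite /flat_list map_allpairs /blocks /coefs [RHS]allpairs_mapl.
congr flatten; apply: eq_map => j; apply: eq_map => v.
by rewrite lincomb_single scalerA.
Qed.

Lemma sumsq_coefs n (c a : 'I_n -> R) : sumsq (coefs c a) = \sum_j (c j * a j) ^+ 2.
Proof. by rewrite /sumsq big_map big_enum. Qed.

Lemma signavg_flat n (c a : 'I_n -> R) (g : V -> R) s :
  signavg (fun y => g (lincomb c y)) (flat_list a s) 0 =
  signavg g (blocks (coefs c a) s) 0.
Proof.
rewrite -map_lincomb_flat.
by rewrite -[X in signavg g _ X](linear0 (lincomb (V := V) c)) signavg_map.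
Qed.

(** The block of [e] is moved to the front; averaging over the signs of the other blocks cannot
    decrease a convex function. *)
Lemma signavg_blocks_ge cs s e : e \in cs ->
  `|e| * signavg N s 0 <= signavg N (blocks cs s) 0.
Proof.
move=> ecs; rewrite -(signavg_seminormZ HN).
have p : perm_eq (blocks cs s) ([seq e *: v | v <- s] ++ blocks (rem e cs) s).
  by apply: (perm_allpairs (t2 := s) _ (perm_to_rem ecs)).
rewrite (signavg_perm _ _ p) signavg_cat; apply: le_signavg => v.
exact/signavg_ge/convexfun_seminorm.
Qed.

Lemma seminorm_lincomb n (c : 'I_n -> R) : seminorm (fun y => N (lincomb c y)).
Proof.
split=> [x y|a x]; first by rewrite linearD (seminormD HN).
by rewrite linearZ /= (seminormZ HN).
Qed.

(** Block [i] alone gives a mean of at least [a i], and the variance is at most [2 a_i^2 W(s)];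
    Chebyshev divides by [a_i^2 / 4], whence the 8. *)
Lemma flat_small_prob n (c a : 'I_n -> R) s i :
  signavg N s 0 = 1 -> 0 < a i -> c i = 1 ->
  \sum_j (c j * a j) ^+ 2 <= 2 * a i ^+ 2 ->
  signavg (fun y => (N (lincomb c y) < a i / 2)%R%:R) (flat_list a s) 0 <= 8 * W s.
Proof.
move=> A1 ai ci csum.
have mean : a i <= signavg (fun y => N (lincomb c y)) (flat_list a s) 0.
  rewrite signavg_flat -[leLHS]mulr1 -[X in _ * X <= _]A1 -{1}(ger0_norm (ltW ai)).
  apply: signavg_blocks_ge; apply/mapP; exists i; rewrite ?mem_enum//.
  by rewrite ci mul1r.
have := signavg_chebyshev (seminorm_lincomb c) (ltW ai) mean.
set p := signavg _ _ _ => h.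
have W2 : sqsum (fun y => N (lincomb c y)) (flat_list a s) =
    (\sum_j (c j * a j) ^+ 2) * W s.
  rewrite -sumsq_coefs -(sqsum_blocks HN) -map_lincomb_flat /sqsum big_map//.
rewrite W2 in h; have W0 := sqsum_ge0 N s.
have h2 : p * (a i ^+ 2 / 4) <= 2 * a i ^+ 2 * W s.
  by apply: le_trans h _; rewrite ler_wpM2r.
have a2 : 0 < a i ^+ 2 / 4 by rewrite divr_gt0// exprn_gt0.
rewrite -(ler_pM2r a2); apply: le_trans h2 _; rewrite le_eqVlt; apply/orP; left.
by apply/eqP; field.
Qed.

(** The coefficients of [y i - y k], or of [y i] alone when [i = k]: diagonal pairs encode the lower
    bounds on the norms, so one family of events covers size and separation. *)
Definition diffcoef n (i k j : 'I_n) : R :=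
  (j == i)%:R - if i == k then 0 else (j == k)%:R.

Lemma diffcoef_sum n (a : 'I_n -> R) i k : 0 < a k -> a k <= a i ->
  \sum_j (diffcoef i k j * a j) ^+ 2 <= 2 * a i ^+ 2.
Proof.
move=> ak aki; apply: (@le_trans _ _ (\sum_j ((j == i)%:R * a j ^+ 2 + (j == k)%:R * a j ^+ 2))).
  apply: ler_sum => j _; rewrite exprMn -mulrDl ler_wpM2r ?sqr_ge0// /diffcoef.
  case: (eqVneq i k) => [->|ik]; case: (eqVneq j k) => [ejk|jk]; rewrite ?ejk /=;
    rewrite ?eqxx//= ?(eq_sym k i) ?(negPf ik) /=; try lra.
  by case: (j == i) => /=; lra.
rewrite big_split /=.
have D (l : 'I_n) : \sum_j (j == l)%:R * a j ^+ 2 = a l ^+ 2.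
  rewrite (bigD1 l)//= eqxx mul1r big1 ?addr0// => j /negPf jl; by rewrite jl mul0r.
rewrite !D.
have : a k ^+ 2 <= a i ^+ 2 by rewrite ler_sqr ?nnegrE; lra.
lra.
Qed.

Lemma lincomb_diffcoef n (i k : 'I_n) (y : 'I_n -> V) :
  lincomb (diffcoef i k) y = y i - (if i == k then 0 else y k).
Proof.
have D (l : 'I_n) : \sum_j (j == l)%:R *: y j = y l.
  rewrite (bigD1 l)//= eqxx scale1r big1 ?addr0// => j /negPf jl; by rewrite jl scale0r.
rewrite /lincomb /diffcoef; case: ifP => _.
  by under eq_bigr do rewrite subr0; rewrite D subr0.
by under eq_bigr do rewrite scalerBl; rewrite sumrB !D.
Qed.

Variables (k m : R) (M : forall n, ('I_n -> V) -> R).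
Hypothesis HM : random_moment N k m M.

(* The points are independent random sign sums of [s], rescaled by the [a i]. *)
Lemma separated_points n (a : 'I_n -> R) s :
  (0 < n)%N -> (forall i, 0 < a i) ->
  (forall y : 'I_n -> V, 0 <= M y) ->
  signavg N s 0 = 1 -> W s <= (32 * n%:R ^+ 2)^-1 ->
  (forall cs, signmoment N (blocks cs s) <= 4 * sumsq cs) ->
  exists y : 'I_n -> V,
    [/\ forall i, a i / 2 <= N (y i),
        forall i l, i != l -> a l <= a i -> a i / 2 <= N (y i - y l) &
        M y <= 8 * \sum_j a j ^+ 2].
Proof.
move=> n0 a0 M0 A1 Ws Bs.
pose bad (il : 'I_n * 'I_n) (y : ('I_n -> V)) : R :=
  ((a il.2 <= a il.1) && (N (lincomb (diffcoef il.1 il.2) y) < a il.1 / 2))%R%:R.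
pose Q := \sum_j a j ^+ 2.
have Q0 : 0 < Q.
  rewrite /Q (bigD1 (Ordinal n0))//= ltr_wpDr ?exprn_gt0//.
  by apply: sumr_ge0 => *; apply: sqr_ge0.
pose S := flat_list a s.
have badP il : signavg (bad il) S 0 <= 8 * W s.
  case: il => i l; rewrite /bad /=.
  have [ali|ali] := boolP (a l <= a i); last first.
    by rewrite /= signavg_cst mulr_ge0// sqsum_ge0.
  rewrite /=; apply: flat_small_prob => //; last exact: diffcoef_sum.
  by rewrite /diffcoef eqxx; case: ifP => [_|->]; rewrite subr0.
have MP : signavg (fun y : 'I_n -> V => M y) S 0 <= 4 * Q.
  apply: (random_moment_signavg HM) => // c.
  rewrite (signavg_flat c a (fun v => N v ^+ 2)) -sumsq_coefs; exact: Bs.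
(* The [n^2] indicators contribute at most [8 n^2 / (32 n^2) = 1/4], the moment at most [1/2]. A
   realisation below 1 has all indicators zero and [M y < 8 Q]. *)
have : signavg (fun y => \sum_il bad il y + (8 * Q)^-1 * M y) S 0 < 1.
  rewrite signavgD signavgZ signavg_sum.
  have h1 : \sum_il signavg (bad il) S 0 <= 4^-1.
    apply: (@le_trans _ _ (\sum_(il : 'I_n * 'I_n) 8 * (32 * n%:R ^+ 2)^-1)).
      by apply: ler_sum => il _; rewrite (le_trans (badP il))// ler_pM2l.
    rewrite sumr_const card_prod card_ord -[leLHS]mulr_natr natrM.
    rewrite le_eqVlt; apply/orP; left; apply/eqP; field.
    by rewrite pnatr_eq0 -lt0n.
  have h2 : (8 * Q)^-1 * signavg (fun y : 'I_n -> V => M y) S 0 <= 2^-1.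
    rewrite mulrC ler_pdivrMr; lra.
  lra.
move=> /signavg_gt_ex[y ylt]; exists y.
have bad0 il : 0 <= bad il y by rewrite /bad ler0n.
have sbad0 : 0 <= \sum_il bad il y by apply: sumr_ge0.
have My0 : 0 <= (8 * Q)^-1 * M y.
  by rewrite mulr_ge0// invr_ge0; lra.
have good i l : a l <= a i -> a i / 2 <= N (lincomb (diffcoef i l) y).
  move=> ali; rewrite leNgt; apply/negP => lt.
  have : bad (i, l) y = 1 by rewrite /bad /= ali lt.
  move: ylt; rewrite (bigD1 (i, l))//=.
  have : 0 <= \sum_(il | il != (i, l)) bad il y by apply: sumr_ge0.
  lra.
split.
- by move=> i; have := good i i (lexx _); rewrite lincomb_diffcoef eqxx subr0.
- by move=> i l il ali; have := good i l ali; rewrite lincomb_diffcoef (negPf il).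
- have : (8 * Q)^-1 * M y < 1 by lra.
  rewrite mulrC ltr_pdivrMr; last by lra.
  by rewrite mul1r -/Q; lra.
Qed.

End SeparatedPoints.

(** * Sums of bumps, type 2 and cotype 2 *)

Section LipschitzTypeCotype.
Context (R : realType) (V : lmodType R) (N : V -> R).
Hypothesis HN : seminorm N.
Hypothesis N_eq0 : forall v, N v = 0 -> v = 0.
Local Notation W := (sqsum N).
Local Notation B := (signmoment N).

Section Bump.
Variables (n : nat) (r : 'I_n -> R) (x y : 'I_n -> V).
Hypothesis r_gt0 : forall j, 0 < r j.
Hypothesis x_le : forall j, N (x j) <= 4 * r j.
Hypothesis y_sep : forall i j, i != j -> r i + r j <= N (y i - y j).
Hypothesis y_ge : forall j, r j <= N (y j).

Definition bump j (z : V) : R := Num.max 0 (1 - N (z - y j) / r j).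

Definition bumps (z : V) : V := \sum_j bump j z *: x j.

Lemma bump_eq0 j z : r j <= N (z - y j) -> bump j z = 0.
Proof.
by move=> h; rewrite /bump; apply/max_idPl; rewrite subr_le0 ler_pdivlMr// mul1r.
Qed.

Lemma bump_neq0 j z : bump j z != 0 -> N (z - y j) < r j.
Proof. by apply: contraNT; rewrite -leNgt => /bump_eq0 ->. Qed.

Lemma bump_lipschitz j z w : `|bump j z - bump j w| <= N (z - w) / r j.
Proof.
apply: (@le_trans _ _ (`|N (z - y j) / r j - N (w - y j) / r j|)).
  rewrite /bump; set a := N (z - y j) / _; set b := N (w - y j) / _.
  case: (leP 0 (1 - a)) => ha; case: (leP 0 (1 - b)) => hb;
    rewrite ler_norml; case: (leP 0 (a - b)) => hab;
    rewrite ?(ger0_norm hab) ?(ltr0_norm hab); apply/andP; split; lra.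
have rj : 0 < (r j)^-1 by rewrite invr_gt0.
rewrite -mulrBl normrM (ger0_norm (ltW rj)) ler_pM2r//; apply: le_trans (seminormB_le HN _ _) _.
by rewrite opprB addrA subrK.
Qed.

Lemma sum_bump_neq0 z : \sum_j (bump j z != 0)%:R <= 1 :> R.
Proof.
have [i bi|b0] := pickP (fun j => bump j z != 0); last first.
  by rewrite big1// => j _; rewrite b0.
rewrite (bigD1 i)//= bi big1 ?addr0// => j ji.
case: (boolP (bump j z != 0)) => // bj.
have := bump_neq0 bi; have := bump_neq0 bj; have := y_sep ji.
have := seminormD HN (z - y i) (- (z - y j)).
by rewrite (seminormN HN) opprB addrC addrA subrK; lra.
Qed.

(** The balls of radius [r j] around the [y j] are disjoint, so at most one bump lives at [z] and
    one at [w]; each of these two terms has Lipschitz constant at most [(1 / r_j) (4 r_j) = 4]. *)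
Lemma bumps_lipschitz z w : N (bumps z - bumps w) <= 8 * N (z - w).
Proof.
rewrite /bumps -sumrB.
apply: le_trans (seminorm_sum HN _ _) _.
apply: (@le_trans _ _ (\sum_j ((bump j z != 0)%:R + (bump j w != 0)%:R) * (4 * N (z - w)))).
  apply: ler_sum => j _; rewrite -scalerBl (seminormZ HN).
  have h0 := seminorm_ge0 HN (z - w).
  have h : `|bump j z - bump j w| * N (x j) <= 4 * N (z - w).
    apply: le_trans (ler_pM _ _ (bump_lipschitz j z w) (x_le j)) _ => //.
      exact: seminorm_ge0.
    by rewrite mulrCA divfK ?gt_eqF.
  case: (eqVneq (bump j z) 0) => [z0|_] /=; last first.
    by apply: le_trans h _; rewrite ler_peMl ?mulr_ge0// lerDl ler0n.
  case: (eqVneq (bump j w) 0) => [w0|_] /=; last by rewrite add0r mul1r.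
  by rewrite z0 w0 subrr normr0 add0r !mul0r.
rewrite -mulr_suml big_split /=.
have h1 := sum_bump_neq0 z; have h2 := sum_bump_neq0 w.
rewrite (_ : 8 * N (z - w) = 2 * (4 * N (z - w))); last by ring.
rewrite ler_wpM2r ?mulr_ge0 ?(seminorm_ge0 HN)//; lra.
Qed.

Lemma bumps0 : bumps 0 = 0.
Proof.
rewrite /bumps big1// => j _; rewrite bump_eq0 ?scale0r//.
by rewrite sub0r (seminormN HN).
Qed.

Lemma bumpsE i : bumps (y i) = x i.
Proof.
rewrite /bumps (bigD1 i)//= big1 ?addr0 => [|j ji].
  by rewrite /bump subrr (seminorm0 HN) mul0r subr0 (max_idPr _)// scale1r.
rewrite bump_eq0 ?scale0r//.
have := y_sep ji; rewrite -opprB (seminormN HN); have := r_gt0 i; lra.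
Qed.

End Bump.

(** Used to discard zero vectors, since the radii of the bumps will be proportional to the norms of
    the target vectors. *)
Lemma signavg_neq0 g s z :
  signavg g [seq v <- s | v != 0] z = signavg (V := V) g s z.
Proof.
elim: s z => [|a s IH] z //=; case: eqVneq => [->|_] /=; last by rewrite !IH.
by rewrite IH subr0 addr0; field.
Qed.

Variables (k m : R) (M : forall n, ('I_n -> V) -> R) (K : R).
Hypothesis k_gt0 : 0 < k.
Hypothesis m_ge0 : 0 <= m.
Hypothesis HM : random_moment N k m M.
Hypothesis K_ge0 : 0 <= K.
Hypothesis M_lipschitz : forall (f : V -> V) (L : R), 0 <= L ->
  (forall x y, N (f x - f y) <= L * N (x - y)) -> f 0 = 0 ->
  forall n (x : 'I_n -> V), M (fun j => f (x j)) <= K * L ^+ 2 * M x.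

Lemma random_moment_pos n (x : 'I_n -> V) : 0 <= M x.
Proof.
apply: le_trans (random_moment_ge HM x).
by apply: mulr_ge0; [exact: ltW | exact: signmoment_ge0].
Qed.

Lemma lipschitz_type2 : exists2 C, 0 <= C & forall s, B s <= C * W s.
Proof.
apply: contrapT => H.
have notype C : exists s, C * W s < B s.
  apply: contrapT => /forallNP HC; apply: H.
  exists (Num.max 0 C) => [|s]; first by rewrite le_max lexx.
  have /negP := HC s; rewrite -leNgt => h; apply: le_trans h _.
  by rewrite ler_wpM2r ?sqsum_ge0// le_max lexx orbT.
(* [8^2] is the squared Lipschitz constant of the bump map, the third 8 comes from [M y <= 8 W(t)],
   and [k] from comparing [M] with [B]. The assumed failure of type 2 produces the points; the bound
   obtained from them is type 2 itself. *)
pose C := 8 ^+ 3 * K / k.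
have C0 : 0 <= C.
  by apply: divr_ge0 (ltW k_gt0); apply: mulr_ge0 K_ge0; apply: exprn_ge0.
apply: H; exists C => // s.
suff main t : all (fun v => v != 0) t -> B t <= C * W t.
  rewrite /signmoment -signavg_neq0.
  apply: le_trans (main _ (filter_all _ _)) _.
  rewrite /sqsum big_filter big_mkcond; apply: ler_wpM2l => //.
  apply: ler_sum => v _; case: ifP => // _; exact: sqr_ge0.
move=> /allP t0.
have [->|tn0] := eqVneq t [::].
  by rewrite /signmoment /sqsum big_nil mulr0 /= (seminorm0 HN) expr0n.
pose n := size t; pose x := tnth (in_tuple t).
have n0 : (0 < n)%N by rewrite lt0n size_eq0.
pose a j := N (x j).
have a0 j : 0 < a j.
  rewrite lt_neqAle (seminorm_ge0 HN) andbT eq_sym.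
  by apply: contra (t0 (x j) (mem_tnth _ _)) => /eqP/N_eq0 ->.
have eta0 : 0 < (32 * n%:R ^+ 2 : R)^-1.
  by rewrite invr_gt0 mulr_gt0// exprn_gt0// ltr0n.
have [s0 [A1 Ws Bs]] := near_extremal HN eta0 notype.
have [y [y1 y2 My]] := separated_points HN HM n0 a0 (@random_moment_pos n) A1 Ws Bs.
(* Two points are at least half the larger of [a i] and [a j] apart, which is no less than
   [r i + r j]. *)
pose r j := a j / 4.
have r0 j : 0 < r j by rewrite divr_gt0.
have xr j : N (x j) <= 4 * r j by rewrite /r mulrC divfK.
have ysep i j : i != j -> r i + r j <= N (y i - y j).
  move=> ij; rewrite /r; have [h|h] := leP (a j) (a i).
    by have := y2 i j ij h; lra.
  rewrite eq_sym in ij; have := y2 j i ij (ltW h).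
  by rewrite -opprB (seminormN HN); lra.
have yge j : r j <= N (y j) by have := y1 j; have := a0 j; rewrite /r; lra.
have := M_lipschitz (ler0n R 8) (bumps_lipschitz r0 xr ysep) (bumps0 x r0 yge) y.
rewrite (_ : (fun j => _) = x); last by apply/funext => j; exact: bumpsE.
move=> h.
have tE : [seq x j | j <- enum 'I_n] = t by rewrite /x map_tnth_enum.
have := random_moment_ge HM x; rewrite tE => h1.
have WE : \sum_j a j ^+ 2 = W t by rewrite -[in RHS]tE /sqsum big_map big_enum.
rewrite WE in My; rewrite /C mulrAC ler_pdivlMr// mulrC.
apply: le_trans h1 _; apply: le_trans h _.
rewrite (_ : 8 ^+ 3 * K * W t = K * 8 ^+ 2 * (8 * W t)); last by ring.
apply: ler_wpM2l My; apply: mulr_ge0 => //; exact: exprn_ge0.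
Qed.

Lemma lipschitz_cotype2 : exists2 C, 0 <= C & forall s, W s <= C * B s.
Proof.
have [T T0 HT] := lipschitz_type2.
have [[v v0]|Vz] := pselect (exists v, N v != 0); last first.
  exists 0 => // s; rewrite mul0r /sqsum big1// => v _.
  by rewrite (_ : N v = 0) ?expr0n//; apply: contrapT => /eqP h; apply: Vz; exists v.
pose e := (N v)^-1 *: v.
have e1 : N e = 1.
  by rewrite (seminormZ HN) ger0_norm ?invr_ge0 ?(seminorm_ge0 HN)// mulVf.
(* The squared truncation level, chosen so that [K * (2 * T * (m / A2)) <= 1/2] and the term in
   [W s] can be absorbed on the left. *)
pose A2 := 1 + 4 * K * T * m.
have A20 : 1 <= A2 by rewrite lerDl !mulr_ge0.
pose A := Num.sqrt A2.
have A0 : 0 < A by rewrite sqrtr_gt0; lra.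
have AE : A ^+ 2 = A2 by rewrite sqr_sqrtr//; lra.
exists (4 * K * A2) => [|s]; first by rewrite !mulr_ge0//; lra.
pose x := tnth (in_tuple s).
have lip u w : N (N u *: e - N w *: e) <= 1 * N (u - w).
  by rewrite -scalerBl (seminormZ HN) e1 mulr1 mul1r seminormB_le.
have f0 : N 0 *: e = 0 by rewrite (seminorm0 HN) scale0r.
have := M_lipschitz ler01 lip f0 x.
rewrite (random_moment_line HM) e1 expr1n !mulr1.
have xE : [seq x j | j <- enum 'I_(size s)] = s by rewrite /x map_tnth_enum.
have WE : \sum_j N (x j) ^+ 2 = W s by rewrite -[in RHS]xE /sqsum big_map big_enum.
have tr : forall c : 'I_(size s) -> R, B [seq c j *: x j | j <- enum 'I_(size s)] <=
    T * \sum_j c j ^+ 2 * N (x j) ^+ 2.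
  move=> c; apply: le_trans (HT _) _; rewrite ler_wpM2l// /sqsum big_map big_enum /=.
  apply: ler_sum => j _.
  by rewrite (seminormZ HN) exprMn real_normK ?num_real.
have := random_moment_truncate HM T0 A0 tr; rewrite xE WE AE => h1 h2.
have W0 := sqsum_ge0 N s; have B0 := signmoment_ge0 N s.
have h3 : K * (2 * T * (m / A2)) <= 2^-1.
  have -> : K * (2 * T * (m / A2)) = 2 * K * T * m / A2 by field; lra.
  have A2p : 0 < A2 by lra.
  by rewrite ler_pdivrMr//; rewrite /A2; lra.
have h4 : W s <= K * (2 * A2 * B s + 2 * T * (m / A2) * W s).
  by apply: le_trans h2 _; rewrite ler_wpM2l.
have h5 := ler_wpM2r W0 h3.
move: h4 h5; rewrite mulrDr !mulrA; lra.
Qed.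

End LipschitzTypeCotype.

(** * Kwapien's theorem *)

Section BinomialAverage.
Context (R : realType).

(** The mean of [h(a + S, b + n - S)], where [S] counts the heads in [n] fair coin flips. *)
Fixpoint binavg (h : nat -> nat -> R) (n a b : nat) : R :=
  if n is n'.+1 then (binavg h n' a.+1 b + binavg h n' a b.+1) / 2 else h a b.

Lemma binavgD h1 h2 n a b :
  binavg (fun i j => h1 i j + h2 i j) n a b = binavg h1 n a b + binavg h2 n a b.
Proof. by elim: n a b => [|n IH] a b //=; rewrite !IH; field. Qed.

Lemma binavgZ c h n a b :
  binavg (fun i j => c * h i j) n a b = c * binavg h n a b.
Proof. by elim: n a b => [|n IH] a b //=; rewrite !IH; field. Qed.

Lemma binavg_cst c n a b : binavg (fun _ _ => c) n a b = c.
Proof. by elim: n a b => [|n IH] a b //=; rewrite !IH; field. Qed.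

Lemma le_binavg h1 h2 n a b : (forall i j, h1 i j <= h2 i j) ->
  binavg h1 n a b <= binavg h2 n a b.
Proof.
by move=> h; elim: n a b => [|n IH] a b //=; rewrite ler_pM2r// lerD.
Qed.

(** Squared bias plus the binomial variance [n / 4]. *)
Lemma binavg_sqr_l c n a b :
  binavg (fun i _ => (i%:R - c) ^+ 2) n a b = (a%:R + n%:R / 2 - c) ^+ 2 + n%:R / 4.
Proof.
elim: n a b => [|n IH] a b /=; first by field.
by rewrite !IH -!natr1; field.
Qed.

Lemma binavg_sqr_r c n a b :
  binavg (fun _ j => (j%:R - c) ^+ 2) n a b = (b%:R + n%:R / 2 - c) ^+ 2 + n%:R / 4.
Proof.
elim: n a b => [|n IH] a b /=; first by field.
by rewrite !IH -!natr1; field.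
Qed.

(** Rounding in [n./2] adds at most [1/4] to the squared bias, which [n > 0] absorbs. *)
Lemma half_sqr_le n : (0 < n)%N ->
  (0%:R + n%:R / 2 - n./2%:R) ^+ 2 + n%:R / 4 <= n%:R :> R.
Proof.
move=> n0; have n1 : 1 <= n%:R :> R by rewrite ler1n.
have E : n%:R = (odd n)%:R + 2 * n./2%:R :> R.
  by rewrite -[in LHS](odd_double_half n) natrD -mul2n natrM.
rewrite mulr0n add0r {1}E; move: n1; move: (n%:R) => t t1.
have -> : ((odd n)%:R + 2 * n./2%:R) / 2 - n./2%:R = (odd n)%:R / 2 :> R by field.
by case: (odd n) => /=; lra.
Qed.

End BinomialAverage.

(** * Asymptotic domination and rotations *)

Section Domination.
Context (R : realType) (V : lmodType R) (N : V -> R).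
Hypothesis HN : seminorm N.
Local Notation B := (signmoment N).
Local Notation W := (sqsum N).

(* Asymptotically, [u n] contributes to a random sum at most what [v n] does,
   whatever other vectors [r] occur in that sum. *)
Definition dominated (u v : nat -> seq V) : Prop :=
  forall d : R, 0 < d -> exists n0 : nat, forall n, (n0 <= n)%N -> forall r,
    B (u n ++ r) <= (1 + d) * B (v n ++ r) + d * n%:R.

Definition copies (u : seq V) (n : nat) : seq V := flatten (nseq n u).

Lemma dominated_perm u v : (forall n, perm_eq (u n) (v n)) -> dominated u v.
Proof.
move=> uv d d0; exists 0 => n _ r.
have p : perm_eq (u n ++ r) (v n ++ r) by rewrite perm_cat2r.
rewrite (signmoment_perm N p).
have : 0 <= B (v n ++ r) by exact: signmoment_ge0.
have : 0 <= n%:R :> R by [].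
nra.
Qed.

Lemma dominated_trans v u w : dominated u v -> dominated v w -> dominated u w.
Proof.
move=> uv vw d d0.
(* With [e <= 1/3], both [(1 + e)^2 - 1] and [(1 + e) e + e] equal [2 e + e^2 <= 3 e <= d]. *)
pose e : R := Num.min d 1 / 3.
have e0 : 0 < e by rewrite divr_gt0// lt_min d0 ltr01.
have ed : 3 * e <= d by rewrite /e mulrC divfK// ge_min lexx.
have e1 : 3 * e <= 1 by rewrite /e mulrC divfK// ge_min lexx orbT.
have [n1 H1] := uv e e0; have [n2 H2] := vw e e0.
exists (maxn n1 n2) => n; rewrite geq_max => /andP[/H1 h1 /H2 h2] r.
apply: le_trans (h1 r) _.
have p : (1 + e) * B (v n ++ r) <= (1 + e) * ((1 + e) * B (w n ++ r) + e * n%:R).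
  by rewrite ler_wpM2l//; lra.
have b0 : 0 <= B (w n ++ r) by exact: signmoment_ge0.
have nn : 0 <= n%:R :> R by [].
have q1 : (1 + e) * (1 + e) <= 1 + d by nra.
have q2 : (1 + e) * e + e <= d by nra.
have q3 := ler_wpM2r b0 q1; have q4 := ler_wpM2r nn q2.
lra.
Qed.

(** The quantification over [r] in [dominated] serves this: [u' n], and then [v n], is taken as part
    of the remaining vectors. *)
Lemma dominated_cat u v u' v' : dominated u v -> dominated u' v' ->
  dominated (fun n => u n ++ u' n) (fun n => v n ++ v' n).
Proof.
move=> uv uv'; apply: (@dominated_trans (fun n => v n ++ u' n)) => d d0.
  have [n0 H] := uv d d0; exists n0 => n /H h r.
  by rewrite -!catA; exact: h.
have [n0 H] := uv' d d0; exists n0 => n /H h r.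
have p w : perm_eq ((v n ++ w) ++ r) (w ++ v n ++ r) by rewrite -catA perm_catCA.
by rewrite !(signmoment_perm N (p _)); exact: h.
Qed.

Lemma signmoment_nseq a x : B (nseq a x) = a%:R * N x ^+ 2.
Proof.
rewrite (_ : nseq a x = [seq c *: x | c <- nseq a 1]); last first.
  by rewrite map_nseq scale1r.
rewrite (signmoment_line HN) /sumsq; congr (_ * _).
by elim: a => [|a IH] /=; rewrite ?big_nil// big_cons IH expr1n -natr1 addrC.
Qed.

Definition natdist (a b : nat) : R := `|a%:R - b%:R|.

(** Missing copies are added for free, since sign moments grow with the family; the surplus copies,
    counted by truncated subtractions, are split off by the weighted triangle inequality. *)
Lemma signmoment_adjust a b a' b' x y r d : 0 < d ->
  B (nseq a x ++ nseq b y ++ r) <= (1 + d) * B (nseq a' x ++ nseq b' y ++ r) +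
  (1 + d^-1) * (2 * (natdist a a' * N x ^+ 2) + 2 * (natdist b b' * N y ^+ 2)).
Proof.
move=> d0.
pose e := (a - a')%N; pose f := (b - b')%N.
have le_nat i j : (i - j)%N%:R <= natdist i j.
  rewrite /natdist; have [ij|ij] := leqP i j; last by rewrite natrB ?ler_norm// ltnW.
  by rewrite (eqP ij).
set s := nseq a' x ++ nseq b' y ++ r.
apply: (@le_trans _ _ (B (s ++ (nseq e x ++ nseq f y)))).
  have p : perm_eq ((nseq a x ++ nseq b y ++ r) ++ (nseq (a' - a) x ++ nseq (b' - b) y))
      (s ++ (nseq e x ++ nseq f y)).
    rewrite /s; apply/permP => P; rewrite !count_cat !count_nseq.
    have E1 : (a + (a' - a) = a' + e)%N by rewrite /e; lia.
    have E2 : (b + (b' - b) = b' + f)%N by rewrite /f; lia.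
    have := congr1 (muln (P x)) E1; have := congr1 (muln (P y)) E2.
    rewrite !mulnDr; lia.
  rewrite -(signmoment_perm N p); exact: signmoment_cat_ge.
apply: le_trans (signmoment_cat_le HN _ _ d0) _.
rewrite lerD2l; apply: ler_wpM2l; first by rewrite addr_ge0 ?invr_ge0 ?(ltW d0).
have := signmoment_cat_le HN (nseq e x) (nseq f y) ltr01.
rewrite invr1 (_ : 1 + 1 = 2 :> R)// !signmoment_nseq => h; apply: le_trans h _.
by apply: lerD; apply: ler_wpM2l => //; apply: ler_wpM2r; rewrite ?sqr_ge0 ?le_nat.
Qed.

Lemma dominated_nseq0 h x :
  dominated (fun n => nseq (h n) x ++ nseq (h n) 0) (fun n => nseq (h n) x) /\
  dominated (fun n => nseq (h n) x) (fun n => nseq (h n) x ++ nseq (h n) 0).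
Proof.
split=> d d0; exists 0 => n _ r.
  have := signmoment_adjust (h n) (h n) (h n) 0 x 0 r d0.
  rewrite /natdist subrr normr0 (seminorm0 HN) expr0n !(mulr0, mul0r, addr0) -catA => h1.
  by apply: le_trans h1 _; rewrite lerDl mulr_ge0// ltW.
have := signmoment_adjust (h n) 0 (h n) (h n) x 0 r d0.
rewrite /natdist subrr normr0 (seminorm0 HN) expr0n !(mulr0, mul0r, addr0) -catA => h1.
by apply: le_trans h1 _; rewrite lerDl mulr_ge0// ltW.
Qed.

(** A random combination [+-(x + y) +- (x - y)] is [+-2x] when the two signs agree and [+-2y]
    otherwise, each half of the time. *)
Lemma signavg_rotate (g : V -> R) x y s z :
  signavg g (x + y :: x - y :: s) z =
  (signavg g (2 *: x :: s) z + signavg g (2 *: y :: s) z) / 2.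
Proof.
rewrite /=.
have D v : 2 *: v = v + v :> V by rewrite scaler_nat mulr2n.
rewrite !D.
have P1 : (x + y) + (x - y) = x + x by rewrite addrACA subrr addr0.
have P2 : (x + y) - (x - y) = y + y by rewrite opprB addrC addrA subrK.
have -> : z + (x + y) + (x - y) = z + (x + x) by rewrite -addrA P1.
have -> : z + (x + y) - (x - y) = z + (y + y) by rewrite -addrA P2.
have -> : z - (x + y) + (x - y) = z - (y + y).
  by rewrite -P2 opprB addrAC [RHS]addrA.
have -> : z - (x + y) - (x - y) = z - (x + x) by rewrite -addrA -opprD P1.
by field.
Qed.

(** Each rotated pair becomes one copy of [2x] or of [2y] by a fair coin, so the multiplicities are
    binomial. *)
Lemma signavg_binavg (g : V -> R) x y s n a b z :
  signavg g (copies [:: x + y; x - y] n ++ nseq a (2 *: x) ++ nseq b (2 *: y) ++ s) z =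
  binavg (fun i j => signavg g (nseq i (2 *: x) ++ nseq j (2 *: y) ++ s) z) n a b.
Proof.
elim: n a b => [|n IH] a b //.
rewrite -[RHS]/((binavg _ n a.+1 b + binavg _ n a b.+1) / 2) -!IH.
set c := copies _ n; set x2 := 2 *: x; set y2 := 2 *: y.
have p1 : perm_eq (x2 :: c ++ nseq a x2 ++ nseq b y2 ++ s)
    (c ++ nseq a.+1 x2 ++ nseq b y2 ++ s).
  by rewrite -cat1s perm_catCA.
have p2 : perm_eq (y2 :: c ++ nseq a x2 ++ nseq b y2 ++ s)
    (c ++ nseq a x2 ++ nseq b.+1 y2 ++ s).
  by rewrite -cat1s perm_catCA perm_cat2l perm_catCA.
by rewrite -(signavg_perm g z p1) -(signavg_perm g z p2) -signavg_rotate.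
Qed.

Lemma ler_natdist e a h : 0 < e -> natdist a h <= e * (a%:R - h%:R) ^+ 2 + e^-1.
Proof.
move=> e0; rewrite /natdist; set t := a%:R - h%:R.
rewrite -[t ^+ 2]real_normK ?num_real//; move: `|t| (normr_ge0 t) => u u0.
have ei : 0 < e^-1 by rewrite invr_gt0.
have : 0 <= e^-1 * ((e * u - 2^-1) ^+ 2) by rewrite mulr_ge0 ?sqr_ge0// ltW.
have -> : e^-1 * ((e * u - 2^-1) ^+ 2) = e * u ^+ 2 - u + e^-1 / 4 by field; lra.
lra.
Qed.

(* The law of large numbers for the number of heads among [n] coin flips *)
Lemma binavg_natdist_small (C1 C2 d : R) : 0 <= C1 -> 0 <= C2 -> 0 < d ->
  exists n0, forall n, (n0 <= n)%N ->
    binavg (fun i j => C1 * natdist i n./2 + C2 * natdist j n./2) n 0 0 <= d * n%:R.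
Proof.
move=> C10 C20 d0.
(* By [ler_natdist] the mean is at most [C (e n + 1 / e)], and [n >= e^-2] makes this at most
   [2 C e n = d n]; the added 1 keeps [C] positive. *)
pose C := C1 + C2 + 1; have C0 : 0 < C by rewrite /C; lra.
pose e := d / (2 * C); have e0 : 0 < e by rewrite divr_gt0// mulr_gt0.
have [n1 _ Hn1] : \forall n \near \oo, e^-1 / e <= n%:R.
  exact: nbhs_infty_ger.
exists n1.+1 => n n1n.
have n0 : (0 < n)%N by rewrite (leq_trans _ n1n).
have en : e^-1 <= e * n%:R.
  by rewrite mulrC -ler_pdivrMr//; apply: Hn1 => /=; rewrite ltnW.
apply: (@le_trans _ _ (binavg (fun i j => C1 * e * (i%:R - n./2%:R) ^+ 2 +
    (C2 * e * (j%:R - n./2%:R) ^+ 2 + (C1 + C2) * e^-1)) n 0 0)).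
  apply: le_binavg => i j.
  have := ler_wpM2l C10 (ler_natdist i n./2 e0).
  have := ler_wpM2l C20 (ler_natdist j n./2 e0).
  lra.
rewrite binavgD binavgD !binavgZ binavg_cst binavg_sqr_l binavg_sqr_r.
have := half_sqr_le R n0; set q := _ + _ => q1.
have h1 : C1 * e * q <= C1 * e * n%:R by rewrite ler_wpM2l// mulr_ge0// ltW.
have h2 : C2 * e * q <= C2 * e * n%:R by rewrite ler_wpM2l// mulr_ge0// ltW.
have h3 : (C1 + C2) * e^-1 <= (C1 + C2) * (e * n%:R).
  by rewrite ler_wpM2l// addr_ge0.
have -> : d = 2 * (C * e) by rewrite /e; field; lra.
have : 0 <= e * n%:R by rewrite mulr_ge0// ltW.
rewrite /C; lra.
Qed.

Lemma dominated_copies_mean x y :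
  dominated (copies [:: x + y; x - y])
    (fun n => nseq n./2 (2 *: x) ++ nseq n./2 (2 *: y)) /\
  dominated (fun n => nseq n./2 (2 *: x) ++ nseq n./2 (2 *: y))
    (copies [:: x + y; x - y]).
Proof.
set x2 := 2 *: x; set y2 := 2 *: y.
have BE n r : B (copies [:: x + y; x - y] n ++ r) =
    binavg (fun i j => B (nseq i x2 ++ nseq j y2 ++ r)) n 0 0.
  exact: (@signavg_binavg _ x y r n 0 0).
have c0 d u : 0 < d -> 0 <= (1 + d^-1) * (2 * N u ^+ 2).
  move=> d0; apply: mulr_ge0; first by rewrite addr_ge0 ?invr_ge0 ?(ltW d0).
  by rewrite mulr_ge0 ?sqr_ge0.
split=> d d0; have [n0 Hn] := binavg_natdist_small (c0 d x2 d0) (c0 d y2 d0) d0;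
    exists n0 => n /Hn h r; rewrite BE -catA.
  apply: le_trans (_ : _ <= binavg (fun i j => (1 + d) *
      B (nseq n./2 x2 ++ nseq n./2 y2 ++ r) + ((1 + d^-1) * (2 * N x2 ^+ 2) *
      natdist i n./2 + (1 + d^-1) * (2 * N y2 ^+ 2) * natdist j n./2)) n 0 0) _.
    apply: le_binavg => i j; have := signmoment_adjust i j n./2 n./2 x2 y2 r d0; lra.
  by rewrite binavgD binavg_cst lerD2l.
rewrite -[leLHS](binavg_cst _ n 0 0).
apply: le_trans (_ : _ <= binavg (fun i j => (1 + d) *
    B (nseq i x2 ++ nseq j y2 ++ r) + ((1 + d^-1) * (2 * N x2 ^+ 2) *
    natdist i n./2 + (1 + d^-1) * (2 * N y2 ^+ 2) * natdist j n./2)) n 0 0) _.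
  apply: le_binavg => i j; have := signmoment_adjust n./2 n./2 i j x2 y2 r d0.
  rewrite /natdist (distrC n./2%:R) (distrC n./2%:R j%:R); lra.
by rewrite binavgD binavgZ lerD2l.
Qed.

Lemma dominated_rotation x y :
  dominated (copies [:: x + y; x - y]) (copies [:: x; x; y; y]) /\
  dominated (copies [:: x; x; y; y]) (copies [:: x + y; x - y]).
Proof.
have [m1 m2] := dominated_copies_mean x y.
have twice v : dominated (copies [:: v; v]) (fun n => nseq n./2 (2 *: v)) /\
    dominated (fun n => nseq n./2 (2 *: v)) (copies [:: v; v]).
  (* With [y = 0] both rotated vectors are [v], so [n] pairs of copies of [v] amount to [n./2]
     copies of [2v], up to zeros. *)
  have := dominated_copies_mean v 0; rewrite addr0 subr0 scaler0 => -[a1 a2].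
  have [z1 z2] := dominated_nseq0 (fun n => n./2) (2 *: v).
  by split; [exact: dominated_trans a1 z1 | exact: dominated_trans z2 a2].
have cat4 n : perm_eq (copies [:: x; x] n ++ copies [:: y; y] n)
    (copies [:: x; x; y; y] n).
  apply/permP => P; rewrite count_cat /copies !count_flatten !map_nseq !sumn_nseq /=.
  lia.
have [x1 x2] := twice x; have [y1 y2] := twice y.
split.
  apply: dominated_trans m1 _; apply: dominated_trans (dominated_perm cat4).
  exact: dominated_cat.
apply: dominated_trans m2; apply: dominated_trans (dominated_cat x1 y1).
by apply: dominated_perm => n; rewrite perm_sym.
Qed.

End Domination.

(** * A Hahn-Banach theorem for abelian groups *)

Section GroupHahnBanach.
Context (R : realType) (G : zmodType).
Implicit Types f p : G -> R.

Lemma le_inf_add (A B : set R) (c : R) : A !=set0 -> B !=set0 ->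
  (forall a b, A a -> B b -> c <= a + b) -> c <= inf A + inf B.
Proof.
move=> A0 B0 H; rewrite -lerBlDl; apply: lb_le_inf => // b Bb.
rewrite lerBlDl -lerBlDr; apply: lb_le_inf => // a Aa.
by rewrite lerBlDr; exact: H.
Qed.

Definition subadditive_fun f : Prop := forall x y, f (x + y) <= f x + f y.

Lemma subadditive_ge f x : subadditive_fun f -> - f (- x) <= f x.
Proof.
move=> sf; have := sf 0 0; have := sf x (- x); rewrite subrr addr0; lra.
Qed.

Lemma subadditive_muln f x n : subadditive_fun f -> f (x *+ n.+1) <= n.+1%:R * f x.
Proof.
move=> sf; elim: n => [|n IH]; first by rewrite mulr1n mul1r.
by rewrite mulrS (le_trans (sf _ _))// -natr1; lra.
Qed.

(** Zorn's lemma in the reversed order: the pointwise infimum of a chain is subadditive, and finite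
    because [f x >= - f (- x) >= - p (- x)]. *)
Lemma minimal_subadditive p : subadditive_fun p ->
  exists f, [/\ subadditive_fun f, forall x, f x <= p x &
    forall h, subadditive_fun h -> (forall x, h x <= f x) -> forall x, f x <= h x].
Proof.
move=> sp.
pose T := {f | subadditive_fun f /\ forall x, f x <= p x}.
pose le (s t : T) : bool := `[< forall x, sval t x <= sval s x >].
have [||A Atot|[f [sf fp]] fmin] :=
  @ZL_preorder T (exist _ p (conj sp (fun x => lexx (p x)))) le.
- by move=> t; apply/asboolP => x.
- move=> r s t /asboolP rs /asboolP st; apply/asboolP => x.
  exact: le_trans (st x) (rs x).
- have [[f0 Af0]|A0] := pselect (A !=set0); last first.
    exists (exist _ p (conj sp (fun x => lexx (p x)))) => s As.
    by exfalso; apply: A0; exists s.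
  pose E x := [set sval s x | s in A].
  have Elb x : has_lbound (E x).
    exists (- p (- x)) => _ [[f [sf fp]] _ <-] /=.
    by apply: le_trans (subadditive_ge _ sf); rewrite lerN2.
  have En x : E x !=set0 by exists (sval f0 x); exists f0.
  have gle s x : A s -> inf (E x) <= sval s x.
    by move=> As; apply: ge_inf => //; exists s.
  have gS : subadditive_fun (fun x => inf (E x)) /\ forall x, inf (E x) <= p x.
    split=> [x y|x]; last first.
      by case: (f0) Af0 => f [sf fp] Af; apply: le_trans (gle _ _ Af) (fp x).
    apply: le_inf_add => // _ _ [s As <-] [t At <-].
    have [/asboolP st|/asboolP ts] := Atot s t As At.
      apply: le_trans (gle _ _ At) _.
      by apply: le_trans (proj1 (svalP t) x y) _; rewrite lerD2r.
    apply: le_trans (gle _ _ As) _.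
    by apply: le_trans (proj1 (svalP s) x y) _; rewrite lerD2l.
  exists (exist (fun f => subadditive_fun f /\ forall x, f x <= p x) _ gS) => s As.
  by apply/asboolP => x /=; exact: gle.
- exists f; split=> // h sh hf x.
  have hp : subadditive_fun h /\ forall x, h x <= p x.
    by split=> // y; exact: le_trans (hf y) (fp y).
  have /asboolP := fmin (exist _ h hp) (asboolT hf).
  exact.
Qed.

(** In a group homogeneity must come from minimality: [inf_n f(n x) / n] is a subadditive minorant,
    by comparison at a common multiple, hence no smaller than [f]. *)
Lemma minimal_subadditive_muln f : subadditive_fun f ->
  (forall h, subadditive_fun h -> (forall x, h x <= f x) -> forall x, f x <= h x) ->
  forall x n, f (x *+ n) = n%:R * f x.
Proof.
move=> sf fmin.
pose E x := [set f (x *+ n.+1) / n.+1%:R | n in [set: nat]].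
have En x : E x !=set0 by exists (f (x *+ 1) / 1); exists 0.
have Elb x : has_lbound (E x).
  exists (- f (- x)) => _ [n _ <-].
  rewrite ler_pdivlMr// mulrC mulrN.
  apply: le_trans (subadditive_ge _ sf); rewrite lerN2 -mulNrn.
  exact: subadditive_muln.
have h1 x : inf (E x) <= f x.
  by apply: ge_inf => //; exists 0 => //; rewrite mulr1n divr1.
have h2 : subadditive_fun (fun x => inf (E x)).
  move=> x y; apply: le_inf_add => // _ _ [n _ <-] [m _ <-].
  apply: (@le_trans _ _ (f ((x + y) *+ (n.+1 * m.+1)) / (n.+1 * m.+1)%:R)).
    by apply: ge_inf => //; exists ((n.+1 * m.+1).-1) => //; rewrite prednK// muln_gt0.
  have nm0 : 0 < (n.+1 * m.+1)%:R :> R by rewrite ltr0n muln_gt0.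
  rewrite ler_pdivrMr//.
  have -> : (x + y) *+ (n.+1 * m.+1) = x *+ n.+1 *+ m.+1 + y *+ m.+1 *+ n.+1.
    by rewrite mulrnDl mulrnA [in X in _ + X]mulnC [X in _ + X]mulrnA.
  apply: le_trans (sf _ _) _.
  have a1 := subadditive_muln (x *+ n.+1) m sf.
  have a2 := subadditive_muln (y *+ m.+1) n sf.
  apply: le_trans (lerD a1 a2) _; rewrite natrM le_eqVlt; apply/orP; left.
  have : n.+1%:R != 0 :> R by rewrite pnatr_eq0.
  have : m.+1%:R != 0 :> R by rewrite pnatr_eq0.
  move: (n.+1%:R : R) (m.+1%:R : R) => u v v0 u0.
  by apply/eqP; field; rewrite v0.
have h3 := fmin _ h2 h1.
have f0 : f 0 = 0.
  have := h3 0; have := sf 0 0; rewrite addr0 => g0 g1.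
  have : inf (E 0) <= f (0 *+ 2) / 2 by apply: ge_inf => //; exists 1%N.
  by rewrite mul0rn; lra.
move=> x [|n]; first by rewrite mulr0n mul0r.
apply: le_anti; rewrite subadditive_muln//=.
have : f x <= f (x *+ n.+1) / n.+1%:R.
  by apply: le_trans (h3 x) _; apply: ge_inf => //; exists n.
by rewrite ler_pdivlMr// mulrC.
Qed.

(** Minimality is used again, against [inf_n (f(x + n z) - n f(z))], bounded below because
    [f(n z) = n f(z)]; the term [n = 1] gives [f(x) + f(z) <= f(x + z)]. *)
Lemma hahn_banach_group p : subadditive_fun p ->
  exists f, (forall x y, f (x + y) = f x + f y) /\ forall x, f x <= p x.
Proof.
move=> sp; have [f [sf fp fmin]] := minimal_subadditive sp.
have fM := minimal_subadditive_muln sf fmin.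
exists f; split=> // x z; apply: le_anti; rewrite sf /= -lerBrDr.
pose E x := [set f (x + z *+ n) - n%:R * f z | n in [set: nat]].
have En u : E u !=set0 by exists (f (u + z *+ 0) - 0%:R * f z); exists 0.
have Elb u : has_lbound (E u).
  exists (- f (- u)) => _ [n _ <-].
  by have := sf (u + z *+ n) (- u); rewrite addrAC subrr add0r fM; lra.
have h1 u : inf (E u) <= f u.
  by apply: ge_inf => //; exists 0 => //; rewrite mulr0n addr0 mul0r subr0.
have h2 : subadditive_fun (fun u => inf (E u)).
  move=> u v; apply: le_inf_add => // _ _ [n _ <-] [m _ <-].
  apply: (@le_trans _ _ (f ((u + v) + z *+ (n + m)) - (n + m)%:R * f z)).
    by apply: ge_inf => //; exists (n + m)%N.
  rewrite mulrnDr addrACA natrD; have := sf (u + z *+ n) (v + z *+ m); lra.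
apply: le_trans (fmin _ h2 h1 x) _; apply: ge_inf => //; exists 1%N => //.
by rewrite mulr1n mul1r.
Qed.

End GroupHahnBanach.

(** * The free abelian group on a set *)

Section MultisetDifference.
Variable T : choiceType.

Definition mset_count (s : seq T) : T -> int := fun x => (count_mem x s)%:Z.

Lemma mset_count_cat s t : mset_count (s ++ t) = mset_count s + mset_count t.
Proof. by apply/funext => x; rewrite /mset_count count_cat PoszD. Qed.

Lemma mset_count_perm s t : mset_count s = mset_count t -> perm_eq s t.
Proof.
move=> st; apply/allP => x _ /=.
by have := congr1 (fun f => f x) st; rewrite /mset_count => -[->].
Qed.

(** Formal differences realised as integer functions: equality is extensional, and an identity
    between multisets gives back a permutation of lists. *)
Definition is_mset_diff : {pred T -> int} :=
  fun g => `[< exists s t, g = mset_count s - mset_count t >].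

Fact is_mset_diff_zmod : zmod_closed is_mset_diff.
Proof.
split=> [|g h /asboolP[s1 [t1 ->]] /asboolP[s2 [t2 ->]]]; apply/asboolP.
  by exists [::], [::]; rewrite subrr.
exists (s1 ++ t2), (t1 ++ s2); rewrite !mset_count_cat opprB addrACA opprD.
by rewrite -!addrA; congr (_ + (_ + _)); rewrite addrC.
Qed.

HB.instance Definition _ := GRing.isZmodClosed.Build (T -> int) is_mset_diff
  is_mset_diff_zmod.

Record mset_diff := MsetDiff { mset_diff_fun : T -> int; _ : mset_diff_fun \in is_mset_diff }.

HB.instance Definition _ := [isSub for mset_diff_fun].
HB.instance Definition _ := [Choice of mset_diff by <:].
HB.instance Definition _ := [SubChoice_isSubZmodule of mset_diff by <:].

Fact mset_diff_subproof s : mset_count s \in is_mset_diff.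
Proof. by apply/asboolP; exists s, [::]; rewrite [mset_count [::]](_ : _ = 0) ?subr0. Qed.

Definition mset (s : seq T) : mset_diff := MsetDiff (mset_diff_subproof s).

Lemma mset_cat s t : mset (s ++ t) = mset s + mset t.
Proof. by apply/val_inj; rewrite raddfD /= mset_count_cat. Qed.

Lemma mset_nil : mset [::] = 0.
Proof. by apply/val_inj; rewrite raddf0. Qed.

Lemma mset_inj s t : mset s = mset t -> perm_eq s t.
Proof. by move=> /(congr1 val); exact: mset_count_perm. Qed.

Lemma mset_diffP (g : mset_diff) : exists s t, g = mset s - mset t.
Proof.
have /asboolP[s [t gst]] : val g \in is_mset_diff by exact: valP.
by exists s, t; apply/val_inj; rewrite raddfB.
Qed.

End MultisetDifference.

(** * A parallelogram form from type 2 and cotype 2 *)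

Section Kwapien.
Context (R : realType) (V : lmodType R) (N : V -> R).
Hypothesis HN : seminorm N.
Local Notation B := (signmoment N).
Local Notation W := (sqsum N).
Variables (T C : R).
Hypothesis (T_ge0 : 0 <= T) (C_ge0 : 0 <= C).
Hypothesis type2 : forall s, B s <= T * W s.
Hypothesis cotype2 : forall s, W s <= C * B s.

Definition domseq (u v : seq V) : Prop := dominated N (copies u) (copies v).

Lemma count_copies P (u : seq V) n : count P (copies u n) = (n * count P u)%N.
Proof. by rewrite /copies count_flatten map_nseq sumn_nseq mulnC. Qed.

Lemma sqsum_copies u n : W (copies u n) = n%:R * W u.
Proof.
elim: n => [|n IH]; first by rewrite /sqsum /copies big_nil mul0r.
by rewrite /copies /= sqsum_cat IH -natr1; ring.
Qed.

Lemma domseq_perm u v : perm_eq u v -> domseq u v.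
Proof.
move=> /permP uv; apply: dominated_perm => n; apply/permP => P.
by rewrite !count_copies uv.
Qed.

Lemma domseq_trans v u w : domseq u v -> domseq v w -> domseq u w.
Proof. exact: dominated_trans. Qed.

Lemma domseq_cat u v u' v' : domseq u v -> domseq u' v' ->
  domseq (u ++ u') (v ++ v').
Proof.
move=> uv uv'.
have p (w w' : seq V) n : perm_eq (copies (w ++ w') n) (copies w n ++ copies w' n).
  by apply/permP => P; rewrite count_cat !count_copies count_cat mulnDr.
apply: dominated_trans (dominated_perm _ (p u u')) _.
apply: dominated_trans (dominated_cat uv uv') _.
by apply: dominated_perm => n; rewrite perm_sym.
Qed.

Lemma le_addmul (a b c : R) : 0 <= c ->
  (forall d, 0 < d -> a <= b + d * c) -> a <= b.
Proof.
move=> c0 H; rewrite leNgt; apply/negP => ba.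
have h0 : 0 < (a - b) / (2 * (c + 1)) by rewrite divr_gt0//; lra.
have := H _ h0.
have e : (a - b) / (2 * (c + 1)) * (c + 1) = (a - b) / 2 by field; lra.
have : (a - b) / (2 * (c + 1)) * c <= (a - b) / (2 * (c + 1)) * (c + 1).
  by rewrite ler_pM2l//; lra.
rewrite e; lra.
Qed.

(** Cotype 2 for [n] copies of [u] and type 2 for [n] copies of [v]; after division by [n], [d]
    tends to 0. *)
Lemma domseq_sqsum u v : domseq u v -> W u <= C * T * W v.
Proof.
move=> uv; apply: (@le_addmul _ _ (C * (T * W v + 1))).
  by rewrite mulr_ge0// addr_ge0// mulr_ge0// sqsum_ge0.
move=> d d0; have [n0 Hn] := uv d d0.
have := Hn n0.+1 (leqnSn _) [::]; rewrite !cats0 => h1.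
have := cotype2 (copies u n0.+1); have := type2 (copies v n0.+1).
rewrite !sqsum_copies => h2 h3.
have n1 : 0 < n0.+1%:R :> R by [].
rewrite -(ler_pM2l n1); apply: le_trans h3 _.
apply: le_trans (ler_wpM2l C_ge0 h1) _.
have h4 : (1 + d) * B (copies v n0.+1) <= (1 + d) * (T * (n0.+1%:R * W v)).
  by rewrite ler_wpM2l// addr_ge0// ltW.
have := ler_wpM2l C_ge0 h4; lra.
Qed.

(* Iterating [b ++ p -> a ++ p] replaces [k] copies of [b] at the cost of one [p]. *)
Lemma domseq_cancel b a p : domseq (b ++ p) (a ++ p) -> W b <= C * T * W a.
Proof.
move=> H; have Hk k : domseq (copies b k ++ p) (copies a k ++ p).
  elim: k => [|k IH]; first exact: domseq_perm.
  apply: (@domseq_trans (b ++ (copies a k ++ p))).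
    rewrite /copies /= -catA; apply: domseq_cat; [exact: domseq_perm | exact: IH].
  apply: (@domseq_trans (copies a k ++ (b ++ p))).
    by apply: domseq_perm; rewrite perm_catCA.
  apply: (@domseq_trans (copies a k ++ (a ++ p))).
    by apply: domseq_cat => //; exact: domseq_perm.
  by apply: domseq_perm; rewrite /copies /= -catA perm_catCA.
apply: (@le_addmul _ _ (C * T * W p)).
  by rewrite mulr_ge0 ?sqsum_ge0// mulr_ge0.
move=> d d0.
have [k _ /(_ k (leqnn k)) Hd] : \forall k \near \oo, d^-1 <= k%:R by exact: nbhs_infty_ger.
have k0 : 0 < k%:R :> R by apply: lt_le_trans Hd; rewrite invr_gt0.
have := domseq_sqsum (Hk k); rewrite !sqsum_cat !sqsum_copies => h.
rewrite -(ler_pM2l k0).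
have h1 : 1 <= d * k%:R by rewrite mulrC -ler_pdivrMr// mul1r.
have h2 : C * T * W p <= d * k%:R * (C * T * W p).
  by rewrite ler_peMl// mulr_ge0 ?sqsum_ge0// mulr_ge0.
have := sqsum_ge0 N p; lra.
Qed.

(* The infimum of these bounds is a subadditive majorant of every additive [F]
   with [N x ^+ 2 <= F (mset [:: x]) <= C * T * N x ^+ 2] that is monotone for
   [domseq]. *)
Definition mset_bounds (g : mset_diff V) : set R :=
  [set r | exists a b u v, [/\ g = mset a - mset b + (mset u - mset v),
     domseq u v & r = C * T * W a - W b]].

Lemma mset_bounds_neq0 g : mset_bounds g !=set0.
Proof.
have [a [b gab]] := mset_diffP g; exists (C * T * W a - W b).
by exists a, b, [::], [::]; split=> //; rewrite ?subrr ?addr0//; exact: domseq_perm.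
Qed.

Lemma mset_boundsD g h r t : mset_bounds g r -> mset_bounds h t ->
  mset_bounds (g + h) (r + t).
Proof.
move=> [a [b [u [v [-> uv ->]]]]] [a' [b' [u' [v' [-> uv' ->]]]]].
exists (a ++ a'), (b ++ b'), (u ++ u'), (v ++ v'); split.
- by rewrite !mset_cat addrACA; congr (_ + _); rewrite addrACA opprD.
- exact: domseq_cat.
- by rewrite !sqsum_cat; ring.
Qed.

(** An identity [a + u = b + v] of multisets permutes [b ++ v] into [a ++ u], which is dominated by
    [a ++ v], and [domseq_cancel] removes [v]. This keeps the infimum of the bounds finite. *)
Lemma mset_bounds_ge0 r : mset_bounds 0 r -> 0 <= r.
Proof.
move=> [a [b [u [v [E uv ->]]]]]; rewrite subr_ge0.
have p : perm_eq (b ++ v) (a ++ u).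
  apply: mset_inj; apply/eqP; rewrite eq_sym -subr_eq0 !mset_cat.
  by rewrite opprD addrACA -E.
apply: (@domseq_cancel b a v); apply: domseq_trans (domseq_perm p) _.
by apply: domseq_cat => //; exact: domseq_perm.
Qed.

Lemma type_cotype_parallelogram :
  exists2 q : V -> R, parallelogram q &
    forall x, N x ^+ 2 <= q x <= C * T * N x ^+ 2.
Proof.
pose p g := inf (mset_bounds g).
have lb g : has_lbound (mset_bounds g).
  have [t Ht] := mset_bounds_neq0 (- g).
  exists (- t) => r Hr; have := mset_boundsD Hr Ht; rewrite subrr.
  by move=> /mset_bounds_ge0; lra.
have pS : subadditive_fun p.
  move=> g h; apply: le_inf_add; [exact: mset_bounds_neq0..|] => r t Hr Ht.
  by apply: ge_inf => //; exact: mset_boundsD.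
have [F [FD Fp]] := hahn_banach_group pS.
have F0 : F 0 = 0 by have := FD 0 0; rewrite addr0; lra.
have FB g h : F (g - h) = F g - F h by have := FD (g - h) h; rewrite subrK; lra.
have Fb g r : mset_bounds g r -> F g <= r.
  by move=> Hr; apply: le_trans (Fp g) _; exact: ge_inf.
have d0 : domseq [::] [::] by exact: domseq_perm.
have Fdom u v : domseq u v -> F (mset u) <= F (mset v).
  move=> uv; rewrite -subr_le0 -FB; apply: Fb; exists [::], [::], u, v.
  by split=> //; [rewrite subrr add0r | rewrite /sqsum !big_nil mulr0 subrr].
have Fcons x s : F (mset (x :: s)) = F (mset [:: x]) + F (mset s).
  by rewrite -cat1s mset_cat FD.
exists (fun x => F (mset [:: x])) => [x y|x].
  (* Domination in both directions gives equality, which is the parallelogram law. *)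
  have [r1 r2] := dominated_rotation HN x y.
  have := Fdom _ _ r1; have := Fdom _ _ r2.
  rewrite (Fcons (x + y) [:: x - y]) (Fcons x [:: x; y; y]) (Fcons x [:: y; y]).
  by rewrite (Fcons y [:: y]); lra.
have W1 : W [:: x] = N x ^+ 2 by rewrite /sqsum big_seq1.
have W0 : W [::] = 0 by rewrite /sqsum big_nil.
apply/andP; split.
  (* The lower bound on [q x] is an upper bound on [F] at the negative of [mset [:: x]]. *)
  have : F (mset [::] - mset [:: x]) <= C * T * W [::] - W [:: x].
    by apply: Fb; exists [::], [:: x], [::], [::]; split=> //; rewrite subrr addr0.
  by rewrite FB mset_nil F0 W0 W1; lra.
have : F (mset [:: x]) <= C * T * W [:: x] - W [::].
  by apply: Fb; exists [:: x], [::], [::], [::]; split=> //; rewrite mset_nil !subr0 addr0.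
by rewrite W0 W1 subr0.
Qed.

End Kwapien.

(** * Renorming with a parallelogram form *)

Section Renorming.
Context (K : numFieldType) (X : completeNormedModType K).

Record equivalent_norm (n : X -> K) (c C : K) : Prop := EquivalentNorm {
  equivalent_normD : forall x y, n (x + y) <= n x + n y;
  equivalent_normZ : forall (k : K) x, n (k *: x) = `|k| * n x;
  equivalent_norm_gt0 : 0 < c /\ 0 < C;
  equivalent_norm_ge : forall x, c * `|x| <= n x;
  equivalent_norm_le : forall x, n x <= C * `|x| }.

(** A copy of [X] whose type mentions [h], so that instance inference finds the norm [n] on it. *)
Definition renormed (n : X -> K) (c C : K) (h : equivalent_norm n c C) : Type := X.

Section RenormedInstances.
Variables (n : X -> K) (c C : K) (h : equivalent_norm n c C).
Local Notation H := (renormed h).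

HB.instance Definition _ := GRing.Lmodule.on H.

Fact renormed_eq0 (x : H) : n x = 0 -> x = 0.
Proof.
move=> nx0; have [c0 _] := equivalent_norm_gt0 h.
have := equivalent_norm_ge h x; rewrite nx0 pmulr_rle0// normr_le0.
by move/eqP.
Qed.

HB.instance Definition _ := Lmodule_isNormed.Build K H
  (equivalent_normD h) (equivalent_normZ h) renormed_eq0.

Lemma renormed_normE (x : H) : `|x| = n x.
Proof. by []. Qed.

Lemma nbhs_renormed (x : X) (B : set X) : nbhs (x : H) B <-> nbhs x B.
Proof.
have [c0 C0] := equivalent_norm_gt0 h.
split=> /nbhs_ballP[e /= e0 eB]; apply/nbhs_ballP.
  exists (e / C) => /=; first exact: divr_gt0.
  move=> y; rewrite -ball_normE /= => xy; apply: eB.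
  rewrite -ball_normE /= renormed_normE.
  by apply: le_lt_trans (equivalent_norm_le h _) _; rewrite mulrC -ltr_pdivlMr.
exists (c * e) => /=; first exact: mulr_gt0.
move=> y; rewrite -ball_normE /= renormed_normE => xy; apply: eB.
rewrite -ball_normE /=.
have := le_lt_trans (equivalent_norm_ge h _) xy.
by rewrite ltr_pM2l.
Qed.

Fact renormed_complete (F : set_system H) : ProperFilter F -> cauchy F -> cvg F.
Proof.
move=> FF /(cauchyP (T := H)) Fc.
have [c0 C0] := equivalent_norm_gt0 h.
have FX : cauchy (F : set_system X).
  apply/cauchyP => e e0; have [x Fx] := Fc (c * e) (mulr_gt0 c0 e0); exists x.
  apply: filterS Fx => y; rewrite -ball_normE /= renormed_normE => xy.
  rewrite -ball_normE /=; have := le_lt_trans (equivalent_norm_ge h _) xy.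
  by rewrite ltr_pM2l.
have [l Fl] := (cvg_in_ex X F).1 (cauchy_cvg (T := X) F FX).
by apply: (cvg_in_ex H F).2; exists l => B /nbhs_renormed; exact: Fl.
Qed.

HB.instance Definition _ := Uniform_isComplete.Build H renormed_complete.

Definition to_renormed (x : X) : H := x.
Definition of_renormed (x : H) : X := x.

Fact to_renormed_linear : linear to_renormed. Proof. by []. Qed.
Fact of_renormed_linear : linear of_renormed. Proof. by []. Qed.

HB.instance Definition _ := GRing.isLinear.Build K X H _ to_renormed to_renormed_linear.
HB.instance Definition _ := GRing.isLinear.Build K H X _ of_renormed of_renormed_linear.

Lemma isomorphic_renormed : isomorphic X H.
Proof.
exists to_renormed, of_renormed; split => // x B.
  by move=> /nbhs_renormed.
by move=> Bx; apply/nbhs_renormed.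
Qed.

End RenormedInstances.
End Renorming.

(** * Polarization of a parallelogram form *)

Section JordanVonNeumann.
Context (R : realType).

(** After subtracting [t * f 1] the function vanishes on integers, hence is periodic and bounded;
    being additive, a nonzero value would grow along multiples. *)
Lemma additive_locally_bounded (f : R -> R) (M : R) :
  (forall s t, f (s + t) = f s + f t) -> (forall t, 0 <= t <= 1 -> `|f t| <= M) ->
  forall t, f t = t * f 1.
Proof.
move=> fD fM.
pose g t := f t - t * f 1.
have gD s t : g (s + t) = g s + g t by rewrite /g fD; ring.
have g0 : g 0 = 0 by have := gD 0 0; rewrite addr0; lra.
have gN t : g (- t) = - g t by have := gD t (- t); rewrite subrr g0; lra.
have g1 : g 1 = 0 by rewrite /g; ring.
have gM t n : g (n%:R * t) = n%:R * g t.
  elim: n => [|n IH]; first by rewrite !mul0r.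
  by rewrite -natr1 !mulrDl !mul1r gD IH.
have gn n : g n%:R = 0 by rewrite -[n%:R]mulr1 gM g1 mulr0.
have gz (z : int) : g z%:~R = 0.
  by case: z => n; rewrite ?NegzE ?mulrNz ?gN gn ?oppr0.
have gb t : `|g t| <= M + `|f 1|.
  have -> : g t = g (t - (Num.floor t)%:~R) by rewrite gD gN gz subr0.
  have h0 := ge_floor t; have h1 := ltW (lt_succ_floor t).
  rewrite intrD in h1; set u := t - _.
  have u01 : 0 <= u <= 1 by rewrite /u; apply/andP; split; lra.
  rewrite /g (le_trans (ler_normB _ _))// lerD ?fM//.
  move/andP: u01 => [u0 u1].
  by rewrite normrM ger0_norm// ler_piMl.
move=> t; apply/eqP; rewrite -subr_eq0 -/(g t) -normr_le0 leNgt; apply/negP => gt.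
have [n _ /(_ n (leqnn n)) Hn] : \forall n \near \oo, (M + `|f 1| + 1) / `|g t| <= n%:R.
  exact: nbhs_infty_ger.
have := gb (n%:R * t); rewrite gM normrM normr_nat => h.
by move: Hn; rewrite ler_pdivrMr//; lra.
Qed.

Section RealPolarization.
Variables (V : lmodType R) (N q : V -> R) (C : R).
Hypothesis HN : seminorm N.
Hypothesis qP : parallelogram q.
Hypothesis q_ge0 : forall x, 0 <= q x.
Hypothesis q_le : forall x, q x <= C * N x ^+ 2.

Definition polar (x y : V) : R := (q (x + y) - q (x - y)) / 4.

Lemma parallelogram0 : q 0 = 0.
Proof. by have := qP 0 0; rewrite subr0 addr0; lra. Qed.

Lemma parallelogramN x : q (- x) = q x.
Proof. by have := qP 0 x; rewrite add0r sub0r parallelogram0; lra. Qed.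

Lemma polarC x y : polar x y = polar y x.
Proof. by rewrite /polar (addrC y x) -(opprB x y) parallelogramN. Qed.

Lemma polarNl x y : polar (- x) y = - polar x y.
Proof.
rewrite /polar -opprD parallelogramN -(parallelogramN (- x + y)) opprD opprK.
by field.
Qed.

Lemma polarxx x : polar x x = q x.
Proof.
rewrite /polar subrr parallelogram0.
by have := qP x x; rewrite subrr parallelogram0; lra.
Qed.

(** The parallelogram law at [u + z] and [u - z] gives [H]; adding its instances for [(x, y)] and
    [(y, x)] cancels the differences. *)
Lemma polarDl x y z : polar (x + y) z = polar x z + polar y z.
Proof.
have H u v : polar (u + v) z + polar (u - v) z = 2 * polar u z.
  rewrite /polar; have := qP (u + z) v; have := qP (u - z) v.
  rewrite (addrAC u v z) (addrAC u v (- z)) (addrAC u (- v) z).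
  by rewrite (addrAC u (- v) (- z)); lra.
have := H x y; have := H y x; rewrite (addrC y x) -(opprB x y) polarNl; lra.
Qed.

Lemma polarDr x y z : polar x (y + z) = polar x y + polar x z.
Proof. by rewrite polarC polarDl !(polarC x). Qed.

Lemma polar_bound x y : `|polar x y| <= (q x + q y) / 2.
Proof.
rewrite /polar ler_norml; have := qP x y; have := q_ge0 (x + y); have := q_ge0 (x - y).
by move=> *; apply/andP; split; lra.
Qed.

(** The form is additive in [t] and, by the upper bound on [q], bounded for [t] in [[0, 1]]. *)
Lemma polarZl t x y : polar (t *: x) y = t * polar x y.
Proof.
rewrite -[x in RHS]scale1r.
apply: (@additive_locally_bounded (fun t => polar (t *: x) y) ((C * N x ^+ 2 + q y) / 2)).
  by move=> u v; rewrite scalerDl polarDl.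
move=> {}t /andP[t0 t1]; apply: le_trans (polar_bound _ _) _.
rewrite ler_pM2r// lerD2r; apply: le_trans (q_le _) _.
rewrite (seminormZ HN) ger0_norm// exprMn.
have c0 : 0 <= C * N x ^+ 2 by apply: le_trans (q_ge0 x) (q_le x).
rewrite mulrCA ler_piMl//; nra.
Qed.

Lemma parallelogramZ t x : q (t *: x) = t ^+ 2 * q x.
Proof. by rewrite -polarxx polarZl polarC polarZl polarxx; ring. Qed.

Lemma parallelogramD x y : q (x + y) = q x + 2 * polar x y + q y.
Proof. by rewrite -polarxx polarDl !polarDr !polarxx (polarC y x); ring. Qed.

Lemma parallelogram_triangle x y : (forall v, q v = 0 -> v = 0) ->
  Num.sqrt (q (x + y)) <= Num.sqrt (q x) + Num.sqrt (q y).
Proof.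
move=> q_eq0.
have [->|y0] := eqVneq y 0; first by rewrite addr0 parallelogram0 sqrtr0 addr0.
have qy : 0 < q y.
  by rewrite lt_neqAle q_ge0 andbT eq_sym; apply: contra y0 => /eqP/q_eq0/eqP.
have cs : polar x y ^+ 2 <= q x * q y.
  (* Cauchy-Schwarz, from the component of [x] orthogonal to [y]. *)
  have := q_ge0 (x + (- (polar x y / q y)) *: y).
  rewrite parallelogramD parallelogramZ polarC polarZl (polarC y) => h.
  have : 0 <= q y * (q x + 2 * (- (polar x y / q y) * polar x y) +
     (- (polar x y / q y)) ^+ 2 * q y) by rewrite mulr_ge0.
  have -> : q y * (q x + 2 * (- (polar x y / q y) * polar x y) +
     (- (polar x y / q y)) ^+ 2 * q y) = q x * q y - polar x y ^+ 2 by field; lra.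
  by rewrite subr_ge0.
have sx := sqr_sqrtr (q_ge0 x); have sy := sqr_sqrtr (q_ge0 y).
have s0 := sqrtr_ge0 (q x); have s1 := sqrtr_ge0 (q y).
rewrite -[leRHS]ger0_norm ?addr_ge0// -sqrtr_sqr ler_wsqrtr//.
rewrite parallelogramD sqrrD sx sy lerD2r lerD2l.
have : polar x y <= Num.sqrt (q x) * Num.sqrt (q y).
  apply: le_trans (ler_norm _) _.
  by rewrite -sqrtr_sqr -sqrtrM// ler_wsqrtr.
by rewrite -mulr_natl; lra.
Qed.

End RealPolarization.
End JordanVonNeumann.

Section HilbertRenorming.
Context (R : realType) (s : scalars).
Local Notation K := (scalar_field R s).

Lemma scalar_conjB : {morph @scalar_conj R s : a b / a - b}.
Proof. by case: s => // a b /=; rewrite rmorphB. Qed.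

Lemma scalar_conjM : {morph @scalar_conj R s : a b / a * b}.
Proof. by case: s => // a b /=; rewrite rmorphM. Qed.

Lemma mul_scalar_conj (k : K) : k * scalar_conj k = `|k| ^+ 2.
Proof.
case: s k => [k|k] /=; first by rewrite real_normK ?num_real.
by rewrite sqr_normc mulrC.
Qed.

Lemma seminorm_rnorm (X : normedModType K) : seminorm (@rnorm R s X : realified X -> R).
Proof. by split; [exact: ler_rnormD | move=> a x; exact: rnormZ]. Qed.

Variable X : completeNormedModType K.
Variables (ip : X -> X -> K) (q : X -> R) (C : R).
Hypothesis ip_linear : forall y, linear_for *%R (ip ^~ y).
Hypothesis ip_conj : forall x y, ip x y = scalar_conj (ip y x).
Hypothesis ipxx : forall x, ip x x = of_real s (q x).
Hypothesis q_parallelogram : parallelogram (V := realified X) q.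
Hypothesis q_ge : forall x, rnorm x ^+ 2 <= q x.
Hypothesis q_le : forall x, q x <= C * rnorm x ^+ 2.

Let q_ge0 x : 0 <= q x.
Proof. exact: le_trans (sqr_ge0 _) (q_ge x). Qed.

Lemma ipZl k x y : ip (k *: x) y = k * ip x y.
Proof.
have D a u v : ip (a *: u + v) y = a * ip u y + ip v y by exact: (ip_linear y a u v).
have z : ip 0 y = 0.
  have := D 1 0 0; rewrite scale1r addr0 mul1r => /eqP.
  by rewrite -subr_eq0 opprD addrA subrr sub0r oppr_eq0 => /eqP.
by have := D k x 0; rewrite z !addr0.
Qed.

Lemma ipBl u v y : ip (u - v) y = ip u y - ip v y.
Proof.
have -> : u - v = -1 *: v + u by rewrite scaleN1r addrC.
have D : ip (-1 *: v + u) y = -1 * ip v y + ip u y by exact: (ip_linear y (-1) v u).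
by rewrite D mulN1r addrC.
Qed.

Lemma ip_hilbert : isomorphic_to_hilbert X.
Proof.
pose n (x : X) : K := of_real s (Num.sqrt (q x)).
have q_eq0 v : q v = 0 -> v = 0.
  move=> qv; apply: rnorm_eq0; apply/eqP; rewrite -sqrf_eq0 eq_le sqr_ge0 andbT.
  by rewrite -qv.
have C1 : 0 <= Num.sqrt C + 1 by rewrite addr_ge0 ?sqrtr_ge0.
have h : equivalent_norm n (of_real s 1) (of_real s (Num.sqrt C + 1)).
  split.
  - move=> x y; rewrite /n -of_realD of_real_le.
    exact: (parallelogram_triangle (seminorm_rnorm X) q_parallelogram q_ge0 q_le).
  - move=> k x; rewrite /n.
    (* The parallelogram law speaks of real scalars; homogeneity for [k] in [K] comes from the
       sesquilinearity of [ip]. *)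
    have E : of_real s (q (k *: x)) = of_real s (rnorm (k : K^o) ^+ 2 * q x).
      rewrite -ipxx ipZl ip_conj ipZl scalar_conjM -ip_conj ipxx mulrA mul_scalar_conj.
      by rewrite of_realM of_realX of_real_rnorm.
    rewrite (of_real_inj E) sqrtrM ?sqr_ge0// of_realM sqrtr_sqr.
    by rewrite ger0_norm ?rnorm_ge0// of_real_rnorm.
  - by rewrite -(of_real0 R s) !of_real_lt; split=> //; rewrite ltr_wpDl ?sqrtr_ge0.
  - move=> x; rewrite /n -of_real_rnorm -of_realM of_real_le mul1r.
    by rewrite -[leLHS]ger0_norm ?rnorm_ge0// -sqrtr_sqr ler_wsqrtr.
  - move=> x; rewrite /n -of_real_rnorm -of_realM of_real_le.
    rewrite -[leRHS]ger0_norm ?mulr_ge0 ?rnorm_ge0// -sqrtr_sqr ler_wsqrtr// exprMn.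
    apply: le_trans (q_le x) _; rewrite ler_wpM2r ?sqr_ge0//.
    have [C0|C0] := leP 0 C; last by rewrite (le_trans (ltW C0)) ?sqr_ge0.
    by rewrite sqrrD sqr_sqrtr// -addrA lerDl expr1n mulr1 addr_ge0// mulrn_wge0// sqrtr_ge0.
exists (renormed h); last exact: isomorphic_renormed.
pose ipH : renormed h -> renormed h -> K := ip.
have m1 (y : renormed h) : zmod_morphism (ipH ^~ y) by move=> u v; exact: ipBl.
have m2 (y : renormed h) : zmod_morphism (ipH y).
  by move=> u v; rewrite /ipH ip_conj ipBl scalar_conjB -!ip_conj.
have m3 (y : renormed h) : scalable_for *%R (ipH ^~ y) by move=> a u; exact: ipZl.
have m4 (y : renormed h) : scalable_for (@scalar_conj R s \; *%R) (ipH y).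
  by move=> a u; rewrite /ipH ip_conj ipZl scalar_conjM -ip_conj.
have herm (x y : renormed h) : ipH x y = (-1) ^+ false * scalar_conj (ipH y x).
  by rewrite expr0 mul1r; exact: ip_conj.
have pos (u : renormed h) : u != 0 -> 0 < ipH u u.
  move=> u0; rewrite /ipH ipxx -(of_real0 R s) of_real_lt lt_neqAle q_ge0 andbT eq_sym.
  by apply: contra u0 => /eqP/q_eq0 ->.
pose b := isBilinear.Build K (renormed h) (renormed h) K *%R
  (@scalar_conj R s \; *%R) ipH m1 m2 m3 m4.
pose f := isHermitianSesquilinear.Build K (renormed h) false (@scalar_conj R s) ipH herm.
pose g := isDotProduct.Build K (renormed h) ipH pos.
pose D : {dot renormed h for @scalar_conj R s} := HB.pack ipH b f g.
by exists D => x; rewrite /D /= renormed_normE /n -of_realX sqr_sqrtr.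
Qed.

End HilbertRenorming.

Section ParallelogramHilbert.
Context (R : realType).

Lemma hilbert_of_parallelogram_real
    (X : completeNormedModType (scalar_field R RealScalars)) (q : X -> R) (C : R) :
  parallelogram (V := realified X) q ->
  (forall x, rnorm x ^+ 2 <= q x <= C * rnorm x ^+ 2) -> isomorphic_to_hilbert X.
Proof.
move=> qP qb.
have q1 x : rnorm x ^+ 2 <= q x by have /andP[] := qb x.
have q2 x : q x <= C * rnorm x ^+ 2 by have /andP[] := qb x.
have q0 x : 0 <= q x by exact: le_trans (sqr_ge0 _) (q1 x).
apply: (@ip_hilbert R RealScalars X (polar (V := realified X) q) q C) => //.
- move=> y k u v; rewrite (polarDl qP).
  by rewrite (polarZl (seminorm_rnorm X) qP q0 q2 k).
- by move=> x y; exact: (polarC qP).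
- by move=> x; exact: (polarxx qP).
Qed.

Section Complex.
Variable X : completeNormedModType (scalar_field R ComplexScalars).
Variables (q : X -> R) (C : R).
Hypothesis qP : parallelogram (V := realified X) q.
Hypothesis qb : forall x, rnorm x ^+ 2 <= q x <= C * rnorm x ^+ 2.

Let J (x : X) : X := ('i%C : R[i]) *: x.

Let JJ x : J (J x) = - x.
Proof. by rewrite /J scalerA -expr2 sqr_i scaleN1r. Qed.

Let JD x y : J (x + y) = J x + J y. Proof. exact: scalerDr. Qed.
Let JB x y : J (x - y) = J x - J y. Proof. exact: scalerBr. Qed.

(* Averaging [q] over the rotation by [i] makes it invariant under unimodular
   scalars. *)
Let Q (x : X) : R := q x + q (J x).

Let QP : parallelogram (V := realified X) Q.
Proof. by move=> x y; rewrite /Q JD JB; have := qP x y; have := qP (J x) (J y); lra. Qed.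

Let rnormJ x : rnorm (J x) = rnorm x.
Proof.
apply: (@of_real_inj R ComplexScalars); rewrite !of_real_rnorm /J normrZ.
by rewrite normc_def /= expr0n expr1n add0r sqrtr1 mul1r.
Qed.

Let Q_ge x : rnorm x ^+ 2 <= Q x.
Proof.
have /andP[h1 _] := qb x; have /andP[h2 _] := qb (J x).
by have := sqr_ge0 (rnorm (J x)); rewrite /Q; lra.
Qed.

Let Q_le x : Q x <= 2 * C * rnorm x ^+ 2.
Proof.
have /andP[_ h1] := qb x; have /andP[_ h2] := qb (J x); rewrite rnormJ in h2.
by rewrite /Q; lra.
Qed.

Let QJ x : Q (J x) = Q x.
Proof. by rewrite /Q JJ (parallelogramN qP) addrC. Qed.

Let P := polar (V := realified X) Q.

Let PJJ x y : P (J x) (J y) = P x y.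
Proof. by rewrite /P /polar -(JD x y) -(JB x y) !QJ. Qed.

Let PC x y : P x y = P y x.
Proof. exact: (polarC QP). Qed.

Let PJl x y : P (J x) y = - P x (J y).
Proof. by rewrite -PJJ JJ /P (polarNl QP). Qed.

Let PDl x y z : P (x + y) z = P x z + P y z.
Proof. exact: (polarDl QP). Qed.

Let PZl (t : R) x y : P ((t%:C%C : R[i]) *: x) y = t * P x y.
Proof.
have Q0 v : 0 <= Q v by exact: le_trans (sqr_ge0 _) (Q_ge v).
exact: (polarZl (seminorm_rnorm X) QP Q0 Q_le t).
Qed.

Lemma hilbert_of_parallelogram_complex : isomorphic_to_hilbert X.
Proof.
(* [P(Jx, y) = - P(x, Jy)] makes this linear for [i] in the first argument, and makes [P(x, Jx)]
   vanish on the diagonal. *)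
pose ip (x y : X) : R[i] := (P x y +i* P x (J y))%C.
apply: (@ip_hilbert R ComplexScalars X ip Q (2 * C)) => //.
- move=> y [a b] u v; rewrite /ip.
  have kE : ((a +i* b)%C : R[i]) *: u = (a%:C%C : R[i]) *: u + (b%:C%C : R[i]) *: J u.
    rewrite /J scalerA -scalerDl; congr (_ *: _).
    by apply/eqP; rewrite eq_complex /= !(mulr0, mulr1, mul0r, subr0, addr0, add0r) !eqxx.
  rewrite kE !PDl !PZl !PJl JJ.
  have -> : P u (- y) = - P u y by rewrite PC /P (polarNl QP) -/P -/(P _ _) PC.
  by apply/eqP; rewrite eq_complex /=; apply/andP; split; apply/eqP; ring.
- move=> x y; rewrite /ip /=; apply/eqP; rewrite eq_complex /= (PC x y) eqxx /=.
  by rewrite -PJl PC.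
- move=> x; rewrite /ip /=; apply/eqP; rewrite eq_complex /=.
  have -> : P x x = Q x by exact: (polarxx QP).
  rewrite eqxx /=; apply/eqP; have := PJl x x; rewrite (PC (J x)); lra.
Qed.

End Complex.

Lemma hilbert_of_parallelogram (s : scalars)
    (X : completeNormedModType (scalar_field R s)) (q : X -> R) (C : R) :
  parallelogram (V := realified X) q ->
  (forall x, rnorm x ^+ 2 <= q x <= C * rnorm x ^+ 2) -> isomorphic_to_hilbert X.
Proof.
case: s X q => X q qP qb.
  exact: hilbert_of_parallelogram_real qP qb.
exact: hilbert_of_parallelogram_complex qP qb.
Qed.

End ParallelogramHilbert.

(** * Symmetric random sums *)

Section Expectation.
Context d (T : measurableType d) (R : realType) (P : probability T R).
Implicit Types f g : T -> R.

Definition summable_rv f : Prop := P.-integrable setT (EFin \o f).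

Definition Ex f : R := \int[P]_w f w.

Lemma summableD f g : summable_rv f -> summable_rv g ->
  summable_rv (fun w => f w + g w).
Proof. exact: integrableD. Qed.

Lemma summableZ c f : summable_rv f -> summable_rv (fun w => c * f w).
Proof. exact: integrableZl. Qed.

Lemma summable_cst c : summable_rv (fun=> c).
Proof. exact: finite_measure_integrable_cst. Qed.

Lemma summable_sum (I : Type) (r : seq I) (f : I -> T -> R) :
  (forall i, summable_rv (f i)) -> summable_rv (fun w => \sum_(i <- r) f i w).
Proof.
move=> fi; elim: r => [|i r IH].
  by under [X in summable_rv X]eq_fun do rewrite big_nil; exact: summable_cst.
by under [X in summable_rv X]eq_fun do rewrite big_cons; exact: summableD.
Qed.

Lemma ExD f g : summable_rv f -> summable_rv g ->
  Ex (fun w => f w + g w) = Ex f + Ex g.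
Proof. exact: RintegralD. Qed.

Lemma ExZ c f : summable_rv f -> Ex (fun w => c * f w) = c * Ex f.
Proof. exact: RintegralZl. Qed.

Lemma Ex_cst c : Ex (fun=> c) = c.
Proof. by rewrite /Ex Rintegral_cst//= [X in fine X]probability_setT mulr1. Qed.

Lemma Ex_sum (I : Type) (r : seq I) (f : I -> T -> R) :
  (forall i, summable_rv (f i)) ->
  Ex (fun w => \sum_(i <- r) f i w) = \sum_(i <- r) Ex (f i).
Proof.
move=> fi; elim: r => [|i r IH].
  by under [X in Ex X]eq_fun do rewrite big_nil; rewrite Ex_cst big_nil.
under [X in Ex X]eq_fun do rewrite big_cons.
by rewrite ExD ?IH ?big_cons//; exact: summable_sum.
Qed.

Lemma le_Ex f g : summable_rv f -> summable_rv g -> (forall w, f w <= g w) ->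
  Ex f <= Ex g.
Proof. by move=> fi gi fg; apply: le_Rintegral. Qed.

Lemma Ex_ge0 f : (forall w, 0 <= f w) -> 0 <= Ex f.
Proof. by move=> f0; exact: Rintegral_ge0. Qed.

Lemma ExE f : summable_rv f -> ('E_P[f] = (Ex f)%:E)%E.
Proof.
move=> fi; rewrite unlock /Ex /Rintegral fineK//; exact: integrable_fin_num.
Qed.

Lemma summable_signavg (V : lmodType R) (g : T -> V -> R) s z :
  (forall v, summable_rv (g^~ v)) -> summable_rv (fun w => signavg (g w) s z).
Proof.
move=> gi; elim: s z => [|a s IH] z //=.
under [X in summable_rv X]eq_fun do rewrite mulrC.
by apply: summableZ; exact: summableD.
Qed.

Lemma Ex_signavg (V : lmodType R) (g : T -> V -> R) s z :
  (forall v, summable_rv (g^~ v)) ->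
  Ex (fun w => signavg (g w) s z) = signavg (fun v => Ex (g^~ v)) s z.
Proof.
move=> gi; elim: s z => [|a s IH] z //=.
under [X in Ex X]eq_fun do rewrite mulrC.
rewrite ExZ; last by apply: summableD; exact: summable_signavg.
by rewrite ExD ?IH 1?mulrC//; exact: summable_signavg.
Qed.

(** Every real function of such a [c] is a simple random variable, so vector-valued sums of simple
    variables need no measurable structure on the space. *)
Definition finite_valued (I : finType) (c : T -> I) : Prop :=
  forall i, measurable (c @^-1` [set i]).

Lemma finite_valuedE (I : finType) (c : T -> I) (F : I -> R) w :
  F (c w) = \sum_i F i * \1_(c @^-1` [set i]) w.
Proof.
rewrite (bigD1 (c w))//= indicE mem_set// mulr1 big1 ?addr0// => i /eqP ic.
by rewrite indicE memNset ?mulr0// => /= /esym.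
Qed.

Lemma summable_finite_valued (I : finType) (c : T -> I) (F : I -> R) :
  finite_valued c -> summable_rv (fun w => F (c w)).
Proof.
move=> cm; under [X in summable_rv X]eq_fun do rewrite finite_valuedE.
by apply: summable_sum => i; apply: summableZ; exact: integrable_indic.
Qed.

Lemma Ex_finite_valued (I : finType) (c : T -> I) (F : I -> R) :
  finite_valued c ->
  Ex (fun w => F (c w)) = \sum_i F i * fine (P (c @^-1` [set i])).
Proof.
move=> cm; under [X in Ex X]eq_fun do rewrite finite_valuedE.
rewrite Ex_sum; last by move=> i; apply: summableZ; exact: integrable_indic.
apply: eq_bigr => i _; rewrite ExZ; last exact: integrable_indic.
by rewrite /Ex /Rintegral integral_indic// setIT.
Qed.

Lemma finite_valued_ffun (I : finType) (idx : R -> I) n (eta : 'I_n -> T -> R) :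
  (forall i, measurable (idx @^-1` [set i])) ->
  (forall j, measurable_fun setT (eta j)) ->
  finite_valued (fun w => [ffun j => idx (eta j w)]).
Proof.
move=> idxm etam f.
have -> : (fun w => [ffun j => idx (eta j w)]) @^-1` [set f] =
    \bigcap_(j in [set: 'I_n]) (eta j @^-1` (idx @^-1` [set f j])).
  apply/seteqP; split=> w /=; first by move=> <- j _ /=; rewrite ffunE.
  by move=> H; apply/ffunP => j; rewrite ffunE; exact: H.
apply: fin_bigcap_measurable => [|j _]; first exact: finite_finset.
by have := etam j measurableT _ (idxm (f j)); rewrite setTI.
Qed.

Lemma dominated_Ex (h : nat -> T -> R) (f g : T -> R) :
  (forall k, summable_rv (h k)) -> (forall w, h ^~ w @ \oo --> f w) ->
  summable_rv g -> (forall k w, `|h k w| <= g w) ->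
  summable_rv f /\ Ex (h k) @[k --> \oo] --> Ex f.
Proof.
move=> hi hf gi hg.
have hm k : measurable_fun setT (EFin \o h k) by exact: measurable_int (hi k).
have hfE x : setT x -> (EFin \o h k) x @[k --> \oo] --> (EFin \o f) x.
  by move=> _; apply: cvg_EFin; [near=> k | exact: hf].
have fm : measurable_fun setT (EFin \o f).
  exact: (emeasurable_fun_cvg (fun k => EFin \o h k)).
have [fi _ cv] := @dominated_convergence _ T R P setT measurableT
  (fun k => EFin \o h k) (EFin \o f) (EFin \o g) hm fm (aeW _ hfE) gi
  (aeW _ (fun x k _ => hg k x)).
split=> //; apply: fine_cvg; rewrite -/(Rintegral P setT f).
by rewrite /Ex /Rintegral fineK//; exact: integrable_fin_num.
Unshelve. all: by end_near.
Qed.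

End Expectation.

Section SimpleApproximation.
Context (R : realType).

Lemma measurable_grid (a b : R) (m i : nat) :
  measurable [set t : R | i%:R <= (Num.max (- a) (Num.min a t) + a) * b < i.+1%:R].
Proof.
pose u (t : R) := (Num.max (- a) (Num.min a t) + a) * b.
have mu : measurable_fun setT u.
  apply: measurable_funM => //; apply: measurable_funD => //.
  by apply: measurable_maxr => //; exact: measurable_minr.
have := mu measurableT _ (measurable_itv `[i%:R, i.+1%:R[%R); rewrite setTI.
by congr measurable; apply/seteqP; split=> t /=; rewrite in_itv.
Qed.

(** Values are clipped to [[-k, k]] and rounded down on a grid of mesh [1 / (k + 1)]. The grid lives
    on the real line and so serves all random variables at once. *)
Lemma simple_approximation_id :
  exists (m : nat -> nat) (idx : forall k, R -> 'I_(m k).+1)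
    (val : forall k, 'I_(m k).+1 -> R),
  [/\ forall k i, measurable (idx k @^-1` [set i]),
      forall k t, `|val k (idx k t)| <= `|t| + 1 &
      forall t, val k (idx k t) @[k --> \oo] --> t].
Proof.
pose clip (k : nat) (t : R) := Num.max (- k%:R) (Num.min k%:R t).
pose u k t := (clip k t + k%:R) * k.+1%:R.
pose m k := (2 * k * k.+1)%N.
pose idx k t : 'I_(m k).+1 := inord (Num.truncn (u k t)).
pose v k (i : 'I_(m k).+1) : R := i%:R / k.+1%:R - k%:R.
have clipP k t : - k%:R <= clip k t <= k%:R.
  rewrite /clip le_max lexx ge_max ge_min lexx andbT /=.
  by have : 0 <= k%:R :> R by []; lra.
have clip_norm k t : `|clip k t| <= `|t|.
  rewrite /clip; have k0 : 0 <= k%:R :> R by [].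
  case: (leP k%:R t) => h1; case: (leP (- k%:R : R) _) => h2;
    by rewrite ler_norml; case: (ger0P t) => ht; apply/andP; split; lra.
have u0 k t : 0 <= u k t.
  by rewrite mulr_ge0//; have /andP[] := clipP k t; lra.
have um k t : u k t <= (m k)%:R.
  rewrite /u /m !natrM ler_wpM2r//.
  by have /andP[_] := clipP k t; lra.
have idxE k t : (idx k t : nat) = Num.truncn (u k t).
  rewrite inordK// ltnS -(ler_nat R); apply: le_trans (um k t).
  by rewrite truncn_le u0.
have close k t : `|v k (idx k t) - clip k t| <= k.+1%:R^-1.
  rewrite /v idxE; have /andP[h1 h2] := truncn_itv (u0 k t).
  have k1 : 0 < k.+1%:R :> R by [].
  have E : clip k t = u k t / k.+1%:R - k%:R by rewrite /u mulfK ?gt_eqF//; ring.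
  rewrite E; set n := Num.truncn _ in h1 h2 *.
  have -> : n%:R / k.+1%:R - k%:R - (u k t / k.+1%:R - k%:R) = - (u k t - n%:R) / k.+1%:R.
    by rewrite mulNr mulrBl; ring.
  rewrite normrM normrN (@ger0_norm _ k.+1%:R^-1) ?invr_ge0// ler_piMl ?invr_ge0//.
  by rewrite -natr1 in h2; rewrite ler_norml; apply/andP; split; lra.
exists m, idx, v; split.
- move=> k i.
  have -> : idx k @^-1` [set i] =
      [set t | (i : nat)%:R <= (Num.max (- k%:R) (Num.min k%:R t) + k%:R) * k.+1%:R
                 < (i : nat).+1%:R].
    apply/seteqP; split=> t /=; rewrite -/(clip k t) -/(u k t) -truncn_eq//.
      by move=> <-; rewrite idxE.
    by move=> /eqP ti; apply: val_inj; rewrite /= idxE.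
  exact: measurable_grid.
- move=> k t; rewrite -[v _ _](subrK (clip k t)) (le_trans (ler_normD _ _))// addrC.
  rewrite lerD//; apply: le_trans (close k t) _.
  by rewrite invf_le1// ler1n.
- move=> t; apply/cvgrPdist_le => e e0.
  have [k1 _ H1] : \forall k \near \oo, `|t| <= k%:R by exact: nbhs_infty_ger.
  have [k2 _ H2] : \forall k \near \oo, e^-1 <= k%:R by exact: nbhs_infty_ger.
  exists (maxn k1 k2) => // k /=; rewrite geq_max => /andP[kk1 kk2].
  have := H1 k kk1; rewrite /= ler_norml => /andP[t1 t2].
  have ck : clip k t = t by rewrite /clip (min_idPr t2) (max_idPr t1).
  rewrite distrC -[in X in _ - X]ck; apply: le_trans (close k t) _.
  have : e^-1 <= k.+1%:R by apply: le_trans (H2 k kk2) _; rewrite ler_nat.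
  by rewrite -[in X in _ -> X](invrK e) lef_pV2// posrE ?invr_gt0.
Qed.

End SimpleApproximation.

(** * Invariance under sign flips *)

Section SignFlip.
Context d (T : measurableType d) (R : realType) (P : probability T R).
Variable xi : nat -> {RV P >-> R}.
Hypothesis xi_indep : independent_rvs xi.
Hypothesis xi_symmetric : forall j, symmetric_rv (xi j).

Definition flip (e : nat -> bool) (j : nat) (w : T) : R := (-1) ^+ e j * xi j w.

Lemma measurable_flip e j : measurable_fun setT (flip e j).
Proof. exact: measurable_funM. Qed.

Lemma prob_flip_preimage e j (A : set R) : measurable A ->
  P (flip e j @^-1` A) = P (xi j @^-1` A).
Proof.
move=> mA; rewrite /flip; case: (e j).
  have -> : (fun w => (-1) ^+ true * xi j w) = (fun w => - xi j w)%R.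
    by apply/funext => w; rewrite expr1 mulN1r.
  by have := xi_symmetric j mA; rewrite /pushforward => ->.
by have -> : (fun w => (-1) ^+ false * xi j w) = xi j
  by apply/funext => w; rewrite expr0 mul1r.
Qed.

(** The signs are absorbed into the sets [A'], independence factors both sides, and the factors
    agree by symmetry. *)
Lemma prob_flip e n (A : nat -> set R) : (forall j, measurable (A j)) ->
  P (\bigcap_(j in [set j | (j < n)%N]) (flip e j @^-1` A j)) =
  P (\bigcap_(j in [set j | (j < n)%N]) (xi j @^-1` A j)).
Proof.
move=> mA.
pose J : {fset nat} := [fset j in iota 0 n]%fset.
have JE : [set` J] = [set j | (j < n)%N].
  by apply/seteqP; split=> j /=; rewrite !inE /= mem_iota.
pose A' j := (fun t : R => (-1) ^+ e j * t) @^-1` A j.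
have mA' j : measurable (A' j).
  have mf : measurable_fun setT (fun t : R => (-1) ^+ e j * t) by exact: measurable_funM.
  by have := mf measurableT _ (mA j); rewrite setTI.
have h1 := xi_indep (J := J) (A := A) (fun j _ => mA j).
have h2 := xi_indep (J := J) (A := A') (fun j _ => mA' j).
rewrite -JE h1.
have -> : \bigcap_(j in [set` J]) (flip e j @^-1` A j) =
    \bigcap_(j in [set` J]) (xi j @^-1` A' j) by [].
rewrite h2; apply: eq_bigr => j _.
by rewrite -(prob_flip_preimage e j (mA j)).
Qed.

Section Simple.
Variables (I : finType) (idx : R -> I) (n : nat).
Hypothesis idx_measurable : forall i, measurable (idx @^-1` [set i]).

Definition flip_index e (w : T) : {ffun 'I_n -> I} := [ffun j : 'I_n => idx (flip e j w)].

Let cell (f : {ffun 'I_n -> I}) (j : nat) : set R :=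
  if insub j is Some j' then idx @^-1` [set f j'] else setT.

Let cell_measurable f j : measurable (cell f j).
Proof. by rewrite /cell; case: insub. Qed.

Let flip_index_preimage e f : flip_index e @^-1` [set f] =
  \bigcap_(j in [set j | (j < n)%N]) (flip e j @^-1` cell f j).
Proof.
apply/seteqP; split=> w /=.
  by move=> <- j /= jn; rewrite /cell insubT /= ffunE.
move=> H; apply/ffunP => j; rewrite ffunE.
by have := H j (ltn_ord j); rewrite /cell valK.
Qed.

Lemma finite_valued_flip_index e : finite_valued (flip_index e).
Proof.
by apply: finite_valued_ffun => // j; exact: measurable_flip.
Qed.

Lemma Ex_sign_flip_simple e (F : {ffun 'I_n -> I} -> R) :
  Ex P (fun w => F (flip_index e w)) = Ex P (fun w => F (flip_index xpred0 w)).
Proof.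
rewrite !Ex_finite_valued; try exact: finite_valued_flip_index.
apply: eq_bigr => f _; congr (_ * fine _).
by rewrite !flip_index_preimage !prob_flip.
Qed.

End Simple.
End SignFlip.

Section SignPatterns.
Context (R : realType).

Fixpoint signs (I : eqType) (r : seq I) : seq (I -> bool) :=
  if r is i :: r' then
    [seq (fun j => if j == i then false else e j) | e <- signs r'] ++
    [seq (fun j => if j == i then true else e j) | e <- signs r']
  else [:: fun=> false].

(** Unfolds the recursion, because expectations are compared for one fixed sign pattern at a
    time. *)
Lemma signavg_signs (V : lmodType R) (g : V -> R) (I : eqType) (r : seq I)
    (y : I -> V) z : uniq r ->
  signavg g [seq y j | j <- r] z =
  2 ^- size r * \sum_(e <- signs r) g (z + \sum_(j <- r) (-1) ^+ e j *: y j).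
Proof.
elim: r z => [|i r IH] z; first by rewrite /= big_seq1 big_nil addr0 expr0 invr1 mul1r.
move=> /= /andP[ir ur]; rewrite !IH// big_cat !big_map /=.
have E (b : bool) e : \sum_(j <- i :: r) (-1) ^+ (if j == i then b else e j) *: y j =
    (-1) ^+ b *: y i + \sum_(j <- r) (-1) ^+ e j *: y j.
  rewrite big_cons eqxx; congr (_ + _); apply: eq_big_seq => j jr.
  by case: eqP => // ji; rewrite ji (negPf ir) in jr.
under [in RHS]eq_bigr do rewrite E expr0 scale1r addrA.
under [X in _ = _ * (_ + X)]eq_bigr do rewrite E expr1 scaleN1r addrA.
by rewrite exprS; field; rewrite expf_neq0.
Qed.

Lemma size_signs (I : eqType) (r : seq I) : size (signs r) = (2 ^ size r)%N.
Proof. by elim: r => //= i r IH; rewrite size_cat !size_map IH addnn -mul2n expnS. Qed.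

End SignPatterns.

Section SeminormSums.
Context (R : realType) (V : lmodType R) (N : V -> R).
Hypothesis HN : seminorm N.
Variables (I : Type) (r : seq I) (x : I -> V).

(** A crude bound, whose purpose is an integrable majorant for dominated convergence. *)
Lemma seminorm_sqr_sum (a : I -> R) :
  N (\sum_(j <- r) a j *: x j) ^+ 2 <= 2 ^+ size r * \sum_(j <- r) a j ^+ 2 * N (x j) ^+ 2.
Proof.
elim: r => [|i s IH]; first by rewrite !big_nil (seminorm0 HN) expr0n mulr0.
rewrite !big_cons /= (exprS 2).
have := seminorm_sqrD HN (a i *: x i) (\sum_(j <- s) a j *: x j) ltr01.
rewrite invr1 (_ : 1 + 1 = 2 :> R)// => h; apply: le_trans h _.
rewrite (seminormZ HN) exprMn real_normK ?num_real//.
have : a i ^+ 2 * N (x i) ^+ 2 <= 2 ^+ size s * (a i ^+ 2 * N (x i) ^+ 2).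
  apply: ler_peMl; first by rewrite mulr_ge0 ?sqr_ge0.
  by rewrite -natrX ler1n expn_gt0.
move: IH; move: (2 ^+ size s : R) (a i ^+ 2 * N (x i) ^+ 2)
  (N (\sum_(j <- s) a j *: x j) ^+ 2) (\sum_(j <- s) a j ^+ 2 * N (x j) ^+ 2) => p A b S.
by move=> h1 h2; lra.
Qed.

Lemma cvg_seminorm_sqr_sum (a : nat -> I -> R) (b : I -> R) :
  (forall j, a ^~ j @ \oo --> b j) ->
  N (\sum_(j <- r) a k j *: x j) ^+ 2 @[k --> \oo] --> N (\sum_(j <- r) b j *: x j) ^+ 2.
Proof.
move=> ab.
suff cN : N (\sum_(j <- r) a k j *: x j) @[k --> \oo] --> N (\sum_(j <- r) b j *: x j).
  by rewrite expr2; under eq_fun do rewrite expr2; exact: cvgM.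
have c0 : \sum_(j <- r) `|b j - a k j| * N (x j) @[k --> \oo] --> (0 : R).
  elim: r => [|i s IH]; first by under eq_fun do rewrite big_nil; exact: cvg_cst.
  under eq_fun do rewrite big_cons.
  have h1 : `|b i - a k i| @[k --> \oo] --> (0 : R).
    have := cvg_norm (cvgB (cvg_cst (b i)) (ab i)).
    by rewrite subrr normr0; apply.
  have h2 : `|b i - a k i| * N (x i) @[k --> \oo] --> (0 : R).
    by have := cvgM h1 (cvg_cst (N (x i))); rewrite mul0r; apply.
  by have := cvgD h2 IH; rewrite addr0; apply.
apply/cvgrPdist_le => e e0; move/cvgrPdist_le : c0 => /(_ e e0); apply: filterS => k.
rewrite sub0r normrN; apply: le_trans; rewrite (le_trans (seminormB_le HN _ _))//.
rewrite -sumrB; under eq_bigr do rewrite -scalerBl.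
apply: le_trans (seminorm_sum HN _ _) _; rewrite ger0_norm; last first.
  by apply: sumr_ge0 => j _; rewrite mulr_ge0// seminorm_ge0.
by apply: ler_sum => j _; rewrite (seminormZ HN).
Qed.

End SeminormSums.

Section RandomSums.
Context d (T : measurableType d) (R : realType) (P : probability T R).
Variables (V : lmodType R) (N : V -> R).
Hypothesis HN : seminorm N.
Local Notation Ex := (Ex P).
Local Notation summable_rv := (summable_rv P).

Section Approximation.
Variables (m : nat -> nat) (idx : forall k, R -> 'I_(m k).+1)
  (val : forall k, 'I_(m k).+1 -> R).
Hypothesis idxm : forall k i, measurable (idx k @^-1` [set i]).
Hypothesis val_le : forall k t, `|val (idx k t)| <= `|t| + 1.
Hypothesis val_cvg : forall t, val (idx k t) @[k --> \oo] --> t.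

Variables (n : nat) (eta : 'I_n -> T -> R) (x : 'I_n -> V).
Hypothesis eta_measurable : forall j, measurable_fun setT (eta j).
Hypothesis eta1 : forall j, summable_rv (fun w => `|eta j w|).
Hypothesis eta2 : forall j, summable_rv (fun w => `|eta j w| ^+ 2).

Definition simple_sum_sqr k (f : {ffun 'I_n -> 'I_(m k).+1}) : R :=
  N (\sum_j val (f j) *: x j) ^+ 2.

Definition eta_index k (w : T) : {ffun 'I_n -> 'I_(m k).+1} :=
  [ffun j => idx k (eta j w)].

Lemma finite_valued_eta_index k : finite_valued (eta_index k).
Proof. exact: (finite_valued_ffun (@idxm k) eta_measurable). Qed.

Lemma random_sum_approximation :
  summable_rv (fun w => N (\sum_j eta j w *: x j) ^+ 2) /\
  Ex (fun w => simple_sum_sqr (eta_index k w)) @[k --> \oo] -->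
    Ex (fun w => N (\sum_j eta j w *: x j) ^+ 2).
Proof.
pose g w := 2 ^+ size (index_enum 'I_n) *
  \sum_j (N (x j) ^+ 2 * (`|eta j w| ^+ 2 + (2 * `|eta j w| + 1))).
apply: (@dominated_Ex _ _ _ _ (fun k w => simple_sum_sqr (eta_index k w)) _ g).
- move=> k; exact: (summable_finite_valued P (@simple_sum_sqr k) (@finite_valued_eta_index k)).
- move=> w; rewrite /simple_sum_sqr.
  apply: (cvg_seminorm_sqr_sum HN (a := fun k j => val (eta_index k w j))) => j.
  by under eq_fun do rewrite ffunE; exact: val_cvg.
- apply: summableZ; apply: summable_sum => j; apply: summableZ.
  apply: (@summableD _ _ _ P (fun w => `|eta j w| ^+ 2) (fun w => 2 * `|eta j w| + 1)) => //.
  apply: (@summableD _ _ _ P (fun w => 2 * `|eta j w|) (fun=> 1)); last exact: summable_cst.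
  exact: summableZ.
- move=> k w; rewrite ger0_norm ?sqr_ge0//.
  apply: le_trans (seminorm_sqr_sum HN _ _ _) _; rewrite ler_wpM2l ?exprn_ge0//.
  apply: ler_sum => j _; rewrite mulrC ler_wpM2l ?sqr_ge0// ffunE.
  rewrite -[leLHS]real_normK ?num_real//.
  apply: (@le_trans _ _ ((`|eta j w| + 1) ^+ 2)).
    by rewrite ler_sqr ?nnegrE// ?addr_ge0.
  by rewrite le_eqVlt; apply/orP; left; apply/eqP; ring.
Qed.

Lemma Ex_approximation j :
  Ex (fun w => val (idx k (eta j w))) @[k --> \oo] --> Ex (eta j).
Proof.
pose I1 k := fun w => [ffun i : 'I_1 => idx k (eta j w)].
have fv k : finite_valued (I1 k).
  exact: (finite_valued_ffun (n := 1) (eta := fun=> eta j) (@idxm k) (fun=> eta_measurable j)).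
have [] // := @dominated_Ex _ _ _ P (fun k w => val (idx k (eta j w))) (eta j)
  (fun w => `|eta j w| + 1).
- move=> k; have := summable_finite_valued P (fun f : {ffun 'I_1 -> _} => val (f ord0)) (fv k).
  by under [X in summable_rv X -> _]eq_fun do rewrite ffunE.
- exact: (summableD (eta1 j) (summable_cst P 1)).
Qed.

Lemma jensen_simple (I : finType) (c : T -> I) (v : 'I_n -> I -> R) :
  finite_valued c ->
  N (\sum_j Ex (fun w => v j (c w)) *: x j) ^+ 2 <=
  Ex (fun w => N (\sum_j v j (c w) *: x j) ^+ 2).
Proof.
move=> cm; pose p i := fine (P (c @^-1` [set i])).
have p0 i : 0 <= p i by rewrite /p fine_ge0.
pose u i := \sum_j v j i *: x j.
have uE : \sum_j Ex (fun w => v j (c w)) *: x j = \sum_i p i *: u i.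
  under eq_bigr do rewrite Ex_finite_valued// scaler_suml.
  rewrite exchange_big; apply: eq_bigr => i _; rewrite scaler_sumr.
  by apply: eq_bigr => j _; rewrite scalerA mulrC.
pose A := Ex (fun w => N (u (c w))).
have s1 : summable_rv (fun w => N (u (c w))) by exact: (summable_finite_valued P (N \o u)).
have s2 : summable_rv (fun w => N (u (c w)) ^+ 2).
  exact: (summable_finite_valued P (fun i => N (u i) ^+ 2)).
have NA : N (\sum_i p i *: u i) <= A.
  apply: le_trans (seminorm_sum HN _ _) _.
  rewrite /A (Ex_finite_valued P (N \o u))//; apply: ler_sum => i _ /=.
  by rewrite (seminormZ HN) ger0_norm// mulrC.
rewrite uE; apply: (@le_trans _ _ (A ^+ 2)).
  have A0 : 0 <= A by apply: Ex_ge0 => w; exact: seminorm_ge0.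
  by rewrite ler_sqr ?nnegrE ?(seminorm_ge0 HN).
have : 0 <= Ex (fun w => N (u (c w)) ^+ 2 + ((- (2 * A)) * N (u (c w)) + A ^+ 2)).
  apply: Ex_ge0 => w.
  have -> : N (u (c w)) ^+ 2 + (- (2 * A) * N (u (c w)) + A ^+ 2) =
    (N (u (c w)) - A) ^+ 2 by ring.
  exact: sqr_ge0.
rewrite ExD//; last by apply: summableD; [exact: summableZ|exact: summable_cst].
rewrite ExD//; [|exact: summableZ|exact: summable_cst].
by rewrite ExZ// Ex_cst -/A; lra.
Qed.

End Approximation.

Lemma jensen_seminorm_sqr n (eta : 'I_n -> T -> R) (x : 'I_n -> V) :
  (forall j, measurable_fun setT (eta j)) ->
  (forall j, summable_rv (fun w => `|eta j w|)) ->
  (forall j, summable_rv (fun w => `|eta j w| ^+ 2)) ->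
  N (\sum_j Ex (eta j) *: x j) ^+ 2 <= Ex (fun w => N (\sum_j eta j w *: x j) ^+ 2).
Proof.
move=> em e1 e2; have [m [idx [val [idxm vle vcvg]]]] := simple_approximation_id R.
have [_ c2] := random_sum_approximation idxm vle vcvg x em e1 e2.
have c1 := cvg_seminorm_sqr_sum HN (r := index_enum 'I_n) (x := x)
  (fun j => Ex_approximation idxm vle vcvg em e1 (j := j)).
apply: (ler_cvg_to c1 c2); near=> k.
have := jensen_simple x (fun j (f : {ffun 'I_n -> 'I_(m k).+1}) => val k (f j))
  (finite_valued_eta_index idxm em (k := k)).
rewrite [X in N X ^+ 2 <= _ -> _](_ : _ = \sum_j Ex (fun w => val k (idx k (eta j w))) *: x j) //.
apply: eq_bigr => j _; congr (Ex _ *: _); apply/funext => w; by rewrite ffunE.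
Unshelve. all: by end_near.
Qed.

End RandomSums.

(** * The second moment of a symmetric random sum *)

Section RandomMomentInstance.
Context d (T : measurableType d) (R : realType) (P : probability T R).
Variable xi : nat -> {RV P >-> R}.
Hypothesis xi_iid : iid xi.
Hypothesis xi_symmetric : forall j, symmetric_rv (xi j).
Hypothesis xi_moments : forall j, finite_moments (xi j).
Hypothesis xi_normalized : forall j, ('E_P[(fun w => `|xi j w| ^+ 2)%R] = 1)%E.
Local Notation Ex := (Ex P).
Local Notation summable_rv := (summable_rv P).

Lemma measurable_abs_moment p : measurable_fun setT (fun t : R => `|t| ^+ p).
Proof. by apply: measurable_funX; exact: normr_measurable. Qed.

Lemma summable_moment j p : summable_rv (fun w => `|xi j w| ^+ p).
Proof.
have mf : measurable_fun setT (fun w => `|xi j w| ^+ p).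
  exact: (measurableT_comp (measurable_abs_moment p)).
apply/integrableP; split; first exact/measurable_EFinP.
have := xi_moments j p; rewrite unlock; apply: le_lt_trans.
by under eq_integral do rewrite /= ger0_norm ?exprn_ge0//.
Qed.

Lemma summable_abs j : summable_rv (fun w => `|xi j w|).
Proof. by have := summable_moment j 1. Qed.

Lemma Ex_abs_sqr j : Ex (fun w => `|xi j w| ^+ 2) = 1.
Proof. by have := xi_normalized j; rewrite (ExE (summable_moment j 2)) => -[]. Qed.

Lemma Ex_moment_eq i j p :
  Ex (fun w => `|xi i w| ^+ p) = Ex (fun w => `|xi j w| ^+ p).
Proof.
rewrite /Ex /Rintegral; congr fine.
have H k : (\int[P]_w (`|xi k w| ^+ p)%:E =
    \int[pushforward P (xi k)]_t (`|t| ^+ p)%:E)%E.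
  have mf : measurable_fun setT (EFin \o (fun t : R => `|t| ^+ p)).
    by apply/measurable_EFinP; exact: measurable_abs_moment.
  have f0 : {in [set: R], forall t : R, (0 <= (`|t| ^+ p)%R%:E)%E}.
    by move=> t _; rewrite lee_fin exprn_ge0.
  exact/esym/(ge0_integral_pushforward (measurable_funPT (xi k)) P measurableT mf f0).
rewrite !H; apply: eq_measure_integral => A mA _.
by have [_ /(_ i j A mA)] := xi_iid.
Qed.

Definition abs_mean : R := Ex (fun w => `|xi 0 w|).
Definition fourth_moment : R := Ex (fun w => `|xi 0 w| ^+ 4).

Lemma fourth_moment_ge0 : 0 <= fourth_moment.
Proof. by apply: Ex_ge0 => w; rewrite exprn_ge0. Qed.

(* [t^2 <= A |t| + t^4 / A^2], so [1 <= A E|xi| + E|xi|^4 / A^2]. *)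
Lemma abs_mean_gt0 : 0 < abs_mean.
Proof.
pose A := fourth_moment + 1; have A0 : 1 <= A by rewrite lerDr fourth_moment_ge0.
have : 1 <= A * abs_mean + (A ^+ 2)^-1 * fourth_moment.
  rewrite -(Ex_abs_sqr 0) -ExZ; last exact: summable_abs.
  rewrite -ExZ; last exact: summable_moment.
  have s1 : summable_rv (fun w => A * `|xi 0 w|) by apply: summableZ; exact: summable_abs.
  have s2 : summable_rv (fun w => (A ^+ 2)^-1 * `|xi 0 w| ^+ 4).
    by apply: summableZ; exact: summable_moment.
  rewrite -ExD//; apply: le_Ex; [exact: summable_moment|exact: summableD|move=> w].
  have t0 := normr_ge0 (xi 0 w); set t := `|xi 0 w| in t0 *.
  have [tA|At] := leP t A.
    have : 0 <= (A ^+ 2)^-1 * t ^+ 4 by rewrite mulr_ge0 ?invr_ge0 ?exprn_ge0//; lra.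
    have : t ^+ 2 <= A * t by rewrite expr2 ler_wpM2r.
    lra.
  have : t ^+ 2 <= (A ^+ 2)^-1 * t ^+ 4.
    have A2 : 0 < A ^+ 2 by rewrite exprn_gt0//; lra.
    rewrite mulrC ler_pdivlMr//.
    rewrite (_ : 4 = 2 + 2)%N// exprD ler_wpM2l ?sqr_ge0//.
    by rewrite ler_sqr ?nnegrE; lra.
  have : 0 <= A * t by rewrite mulr_ge0//; lra.
  lra.
have h : (A ^+ 2)^-1 * fourth_moment < 1.
  have A2 : 0 < A ^+ 2 by rewrite exprn_gt0//; lra.
  rewrite mulrC ltr_pdivrMr// mul1r; have := fourth_moment_ge0.
  by rewrite /A; move: fourth_moment => t t0; nra.
move=> h1; have : 0 < A * abs_mean by lra.
by rewrite pmulr_rgt0//; lra.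
Qed.

Section Seminorm.
Variables (V : lmodType R) (N : V -> R).
Hypothesis HN : seminorm N.
Local Notation B := (signmoment N).

Definition randmoment n (x : 'I_n -> V) : R :=
  Ex (fun w => N (\sum_(j < n) xi j w *: x j) ^+ 2).

(** Both expectations are limits of those of the finite-valued approximations, which agree by
    [Ex_sign_flip_simple]. *)
Lemma Ex_flip n (x : 'I_n -> V) (e : nat -> bool) :
  summable_rv (fun w => N (\sum_(j < n) flip xi e j w *: x j) ^+ 2) /\
  Ex (fun w => N (\sum_(j < n) flip xi e j w *: x j) ^+ 2) = randmoment x.
Proof.
have [m [idx [val [idxm vle vcvg]]]] := simple_approximation_id R.
have flip_abs e' j w : `|flip xi e' j w| = `|xi j w|.
  by rewrite /flip normrM normrX normrN1 expr1n mul1r.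
have ap e' := random_sum_approximation (P := P) HN idxm vle vcvg x
  (eta := fun j : 'I_n => flip xi e' j) (fun j => measurable_flip xi e' j).
have s1 e' (j : 'I_n) : summable_rv (fun w => `|flip xi e' j w|).
  by under [X in summable_rv X]eq_fun do rewrite flip_abs; exact: summable_abs.
have s2 e' (j : 'I_n) : summable_rv (fun w => `|flip xi e' j w| ^+ 2).
  by under [X in summable_rv X]eq_fun do rewrite flip_abs; exact: summable_moment.
have [se ce] := ap e (s1 e) (s2 e); split=> //.
have [_ c0] := ap xpred0 (s1 xpred0) (s2 xpred0).
pose S e' k := Ex (fun w =>
  simple_sum_sqr N val x (eta_index idx (fun j : 'I_n => flip xi e' j) k w)).
have E : S e = S xpred0.
  apply/funext => k.
  exact: (Ex_sign_flip_simple xi_iid.1 xi_symmetric (@idxm k) e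
    (@simple_sum_sqr _ _ N m val n x k)).
rewrite -/(S e) E in ce.
rewrite (cvg_unique (@Rhausdorff R) ce c0) /randmoment.
by congr Ex; apply/funext => w; under eq_bigr do rewrite /flip expr0 mul1r.
Qed.

Lemma summable_randmoment n (x : 'I_n -> V) :
  summable_rv (fun w => N (\sum_(j < n) xi j w *: x j) ^+ 2).
Proof.
have [+ _] := Ex_flip x xpred0; congr summable_rv.
by apply/funext => w; under eq_bigr do rewrite /flip expr0 mul1r.
Qed.

Lemma randmoment_ge0 n (x : 'I_n -> V) : 0 <= randmoment x.
Proof. by apply: Ex_ge0 => w; exact: sqr_ge0. Qed.

Lemma Ex_signs n (x : 'I_n -> V) (e : 'I_n -> bool) :
  summable_rv (fun w => N (0 + \sum_(j <- enum 'I_n) (-1) ^+ e j *: (xi j w *: x j)) ^+ 2) /\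
  Ex (fun w => N (0 + \sum_(j <- enum 'I_n) (-1) ^+ e j *: (xi j w *: x j)) ^+ 2) =
  randmoment x.
Proof.
pose e' j := if insub j is Some i then e i else false.
have [s1 <-] := Ex_flip x e'.
have E : (fun w => N (0 + \sum_(j <- enum 'I_n) (-1) ^+ e j *: (xi j w *: x j)) ^+ 2) =
    (fun w => N (\sum_(j < n) flip xi e' j w *: x j) ^+ 2).
  apply/funext => w; rewrite add0r big_enum /=; congr (N _ ^+ 2); apply: eq_bigr => j _.
  by rewrite /flip /e' valK scalerA.
by rewrite E.
Qed.

(** Each of the [2^n] sign patterns leaves the expectation unchanged, hence so does their
    average. *)
Lemma randmoment_signmoment n (x : 'I_n -> V) :
  summable_rv (fun w => B [seq xi j w *: x j | j : 'I_n <- enum 'I_n]) /\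
  Ex (fun w => B [seq xi j w *: x j | j : 'I_n <- enum 'I_n]) = randmoment x.
Proof.
pose F e w := N (0 + \sum_(j <- enum 'I_n) (-1) ^+ (e j : bool) *: (xi j w *: x j)) ^+ 2.
have E : (fun w => B [seq xi j w *: x j | j : 'I_n <- enum 'I_n]) =
    (fun w => 2 ^- size (enum 'I_n) * \sum_(e <- signs (enum 'I_n)) F e w).
  by apply/funext => w; rewrite /signmoment signavg_signs// enum_uniq.
have Fs e : summable_rv (F e) by have [] := Ex_signs x e.
have FE e : Ex (F e) = randmoment x by have [] := Ex_signs x e.
rewrite E; split; first by apply: summableZ; exact: summable_sum.
rewrite ExZ; last exact: summable_sum.
rewrite Ex_sum//; under eq_bigr do rewrite FE.
rewrite big_const_seq count_predT size_signs iter_addr_0 -(mulr_natr (randmoment x)) natrX mulrCA.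
by rewrite mulVf ?mulr1// expf_neq0.
Qed.

Lemma signavg_abs (I : Type) (r : seq I) (c : I -> R) (y : I -> V) (g : V -> R) z :
  signavg g [seq c i *: y i | i <- r] z = signavg g [seq `|c i| *: y i | i <- r] z.
Proof.
elim: r z => [|i r IH] z //=; rewrite !IH.
by case: (ger0P (c i)) => // _; rewrite scaleNr opprK addrC.
Qed.

(** Inside the sign average [xi j] may be replaced by its absolute value; for each pattern, Jensen's
    inequality then moves the expectation inside the seminorm. *)
Lemma randmoment_ge n (x : 'I_n -> V) :
  abs_mean ^+ 2 * B [seq x j | j <- enum 'I_n] <= randmoment x.
Proof.
have [sB <-] := randmoment_signmoment x.
pose F e w := N (0 + \sum_(j <- enum 'I_n) (-1) ^+ (e j : bool) *: (`|xi j w| *: x j)) ^+ 2.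
have E : (fun w => B [seq xi j w *: x j | j : 'I_n <- enum 'I_n]) =
    (fun w => 2 ^- size (enum 'I_n) * \sum_(e <- signs (enum 'I_n)) F e w).
  by apply/funext => w; rewrite /signmoment signavg_abs signavg_signs// enum_uniq.
pose eta e (j : 'I_n) w := (-1) ^+ (e j : bool) * `|xi j w|.
have FE e : F e = fun w => N (\sum_j eta e j w *: x j) ^+ 2.
  apply/funext => w; rewrite /F add0r big_enum; congr (N _ ^+ 2).
  by apply: eq_bigr => j _; rewrite scalerA.
have em e j : measurable_fun setT (eta e j).
  by apply: measurable_funM => //; exact: measurableT_comp.
have ea e j w : `|eta e j w| = `|xi j w|.
  by rewrite /eta normrM normrX normrN1 expr1n mul1r normr_id.
have e1 e j : summable_rv (fun w => `|eta e j w|).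
  by under [X in summable_rv X]eq_fun do rewrite ea; exact: summable_abs.
have e2 e j : summable_rv (fun w => `|eta e j w| ^+ 2).
  by under [X in summable_rv X]eq_fun do rewrite ea; exact: summable_moment.
have Fs e : summable_rv (F e).
  rewrite FE; have [m [idx [val [idxm vle vcvg]]]] := simple_approximation_id R.
  by have [] := random_sum_approximation HN idxm vle vcvg x (em e) (e1 e) (e2 e).
rewrite E ExZ; last exact: summable_sum.
rewrite Ex_sum// -(signmomentZ HN) /signmoment -map_comp.
rewrite signavg_signs ?enum_uniq// ler_wpM2l ?invr_ge0 ?exprn_ge0//.
apply: ler_sum => e _; rewrite FE.
apply: le_trans (jensen_seminorm_sqr HN x (em e) (e1 e) (e2 e)).
rewrite le_eqVlt; apply/orP; left; apply/eqP; rewrite add0r big_enum; congr (N _ ^+ 2).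
apply: eq_bigr => j _; rewrite /= scalerA; congr (_ *: _).
rewrite /eta ExZ; last exact: summable_abs.
by congr (_ * _); exact: (Ex_moment_eq 0 j 1).
Qed.

Lemma randmoment_line n (t : 'I_n -> R) (v : V) :
  randmoment (fun j => t j *: v) = (\sum_j t j ^+ 2) * N v ^+ 2.
Proof.
have [_ <-] := randmoment_signmoment (fun j => t j *: v).
have E : (fun w => B [seq xi j w *: (t j *: v) | j : 'I_n <- enum 'I_n]) =
    (fun w => N v ^+ 2 * \sum_(j <- enum 'I_n) t j ^+ 2 * `|xi j w| ^+ 2).
  apply/funext => w; have -> : [seq xi j w *: (t j *: v) | j : 'I_n <- enum 'I_n] =
      [seq c *: v | c <- [seq xi j w * t j | j : 'I_n <- enum 'I_n]].
    by rewrite -[RHS]map_comp; apply: eq_map => j /=; rewrite scalerA.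
  rewrite (signmoment_line HN) /sumsq big_map mulrC; congr (_ * _).
  by apply: eq_bigr => j _; rewrite exprMn mulrC real_normK ?num_real.
have sj (j : 'I_n) : summable_rv (fun w => t j ^+ 2 * `|xi j w| ^+ 2).
  by apply: summableZ; exact: summable_moment.
rewrite E ExZ; last exact: summable_sum.
rewrite Ex_sum// mulrC big_enum; congr (_ * _); apply: eq_bigr => j _.
by rewrite ExZ ?Ex_abs_sqr ?mulr1//; exact: summable_moment.
Qed.

Lemma randmoment_truncate n (x : 'I_n -> V) (C A : R) :
  0 <= C -> 0 < A ->
  (forall c : 'I_n -> R, B [seq c j *: x j | j <- enum 'I_n] <=
     C * \sum_j c j ^+ 2 * N (x j) ^+ 2) ->
  randmoment x <= 2 * A ^+ 2 * B [seq x j | j <- enum 'I_n] +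
    2 * C * (fourth_moment / A ^+ 2) * \sum_j N (x j) ^+ 2.
Proof.
move=> C0 A0 H; have [sB <-] := randmoment_signmoment x.
pose b := 2 * A ^+ 2 * B [seq x j | j <- enum 'I_n].
pose G w := 2 * C * \sum_(j <- enum 'I_n) (N (x j) ^+ 2 / A ^+ 2) * `|xi j w| ^+ 4.
have sj (j : 'I_n) : summable_rv (fun w => (N (x j) ^+ 2 / A ^+ 2) * `|xi j w| ^+ 4).
  by apply: summableZ; exact: summable_moment.
have sG : summable_rv G by apply: summableZ; exact: summable_sum.
have bound w : B [seq xi j w *: x j | j : 'I_n <- enum 'I_n] <= b + G w.
  (* The part below the level [A] is handled by contraction. The rest is handled by the hypothesis
     on coefficients, with [t^2 <= t^4 / A^2] where [|t| > A]. *)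
  pose u (j : 'I_n) := if `|xi j w| <= A then xi j w else 0 : R.
  pose v (j : 'I_n) := if `|xi j w| <= A then 0 else xi j w : R.
  have -> : [seq xi j w *: x j | j : 'I_n <- enum 'I_n] =
      [seq u j *: x j + v j *: x j | j <- enum 'I_n].
    apply: eq_map => j; rewrite -scalerDl /u /v.
    by case: ifP; rewrite ?addr0 ?add0r.
  apply: le_trans (signmoment_mapD HN _ _ _) _; apply: lerD.
    rewrite /b -mulrA ler_pM2l// -(signmomentZ HN).
    have -> : [seq A *: y | y <- [seq x j | j <- enum 'I_n]] =
        [seq A *: x j | j <- enum 'I_n] by rewrite -[LHS]map_comp.
    apply: (@signmoment_contract _ _ _ HN _ _ u (fun=> A) x) => j; rewrite /u.
    by case: ifP => // _; rewrite normr0 ltW.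
  rewrite /G -mulrA ler_pM2l//; apply: le_trans (H v) _; rewrite ler_wpM2l// big_enum.
  apply: ler_sum => j _; rewrite mulrC -mulrA ler_wpM2l ?sqr_ge0// /v.
  case: ifP => [_|/negbT]; first by rewrite expr0n mulr_ge0 ?invr_ge0 ?exprn_ge0// ltW.
  rewrite -ltNge => h; rewrite mulrC ler_pdivlMr ?exprn_gt0//.
  rewrite -[xi j w ^+ 2]real_normK ?num_real// (_ : 4 = 2 + 2)%N// exprD.
  by rewrite ler_wpM2l ?sqr_ge0// ler_sqr ?nnegrE ?(ltW A0) ?(ltW h).
apply: (@le_trans _ _ (Ex (fun w => b + G w))).
  by apply: le_Ex => //; apply: summableD => //; exact: summable_cst.
rewrite ExD//; last exact: summable_cst.
rewrite Ex_cst lerD2l /G ExZ; last exact: summable_sum.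
rewrite Ex_sum// le_eqVlt; apply/orP; left; apply/eqP; rewrite -[RHS]mulrA; congr (_ * _).
rewrite big_enum mulr_sumr; apply: eq_bigr => j _.
rewrite ExZ; last exact: summable_moment.
by rewrite (Ex_moment_eq j 0) -/fourth_moment; ring.
Qed.

(** The expectation is exchanged with the finite average, and the hypothesis is applied pointwise
    with [c j = xi j w]. *)
Lemma randmoment_signavg n (s : seq ('I_n -> V)) (a : 'I_n -> R) (C : R) :
  0 <= C ->
  (forall c : 'I_n -> R, signavg (fun y => N (lincomb c y) ^+ 2) s 0 <=
     C * \sum_j (c j * a j) ^+ 2) ->
  signavg (fun y => randmoment y) s 0 <= C * \sum_j a j ^+ 2.
Proof.
move=> C0 H.
rewrite /randmoment -(Ex_signavg
  (g := fun w (y : 'I_n -> V) => N (\sum_(j < n) xi j w *: y j) ^+ 2)); last first.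
  by move=> y; exact: summable_randmoment.
pose G w := C * \sum_(j <- enum 'I_n) a j ^+ 2 * `|xi j w| ^+ 2.
have sj (j : 'I_n) : summable_rv (fun w => a j ^+ 2 * `|xi j w| ^+ 2).
  by apply: summableZ; exact: summable_moment.
have sG : summable_rv G by apply: summableZ; exact: summable_sum.
apply: (@le_trans _ _ (Ex G)).
  apply: le_Ex => //; first by apply: summable_signavg => y; exact: summable_randmoment.
  move=> w; apply: le_trans (H (fun j => xi j w)) _.
  rewrite /G ler_wpM2l// big_enum; apply: ler_sum => j _.
  by rewrite exprMn mulrC real_normK ?num_real.
rewrite /G ExZ; last exact: summable_sum.
rewrite Ex_sum// big_enum ler_wpM2l//; apply: ler_sum => j _.
by rewrite ExZ ?Ex_abs_sqr ?mulr1//; exact: summable_moment.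
Qed.

Lemma randmoment_random_moment :
  random_moment N (abs_mean ^+ 2) fourth_moment randmoment.
Proof.
split.
- exact: randmoment_ge.
- exact: randmoment_line.
- exact: randmoment_truncate.
- exact: randmoment_signavg.
Qed.

End Seminorm.
End RandomMomentInstance.

Section LipschitzConstant.
Context (R : realType) (s : scalars).
Local Notation K := (scalar_field R s).

Lemma scalar_real_lt (M : K) : M \is Num.real -> exists2 L : R, 0 <= L & M < of_real s L.
Proof.
move=> Mr; exists (scalar_re `|M| + 1).
  by rewrite addr_ge0// -(of_real_le s) scalar_reK// of_real0.
rewrite of_realD scalar_reK// of_real1; apply: le_lt_trans (real_ler_norm Mr) _.
by rewrite ltrDl.
Qed.

Section Lipschitz.
Variables (X Y : normedModType K) (f : X -> Y).
Let lips := [set L : R | 0 <= L /\ (of_real s L).-lipschitz f].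

Lemma lip_const_le L : 0 <= L -> (of_real s L).-lipschitz f -> lip_const f <= L.
Proof. by move=> L0 fL; apply: ge_inf; [exists 0 => l [] | split]. Qed.

Lemma lipschitz_neq0 : lipschitz f -> lips !=set0.
Proof.
move=> [M [Mr fM]]; have [L L0 ML] := scalar_real_lt Mr.
by exists L; split=> //; exact: fM.
Qed.

Lemma lip_const_ge0 : lipschitz f -> 0 <= lip_const f.
Proof. by move=> /lipschitz_neq0 n0; apply: lb_le_inf => // l []. Qed.

Lemma lip_constP x y : lipschitz f ->
  rnorm (f x - f y) <= lip_const f * rnorm (x - y).
Proof.
move=> /lipschitz_neq0 n0.
have [r0|r0] := eqVneq (rnorm (x - y)) 0.
  have [L [_ /of_real_lipschitz fL]] := n0.
  by rewrite r0 mulr0; have := fL x y; rewrite r0 mulr0.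
have rp : 0 < rnorm (x - y) by rewrite lt_neqAle eq_sym r0 rnorm_ge0.
rewrite -ler_pdivrMr//; apply: lb_le_inf => // L [_ /of_real_lipschitz fL].
by rewrite ler_pdivrMr.
Qed.

End Lipschitz.

Lemma rnorm_bounded_linear (X Y : normedModType K) (f : {linear X -> Y}) :
  continuous f -> exists2 a : R, 0 <= a & forall x, rnorm (f x) <= a * rnorm x.
Proof.
move=> fc; have /linear_boundedP[M [Mr fM]] := continuous_linear_bounded 0 (fc 0).
have [L L0 ML] := scalar_real_lt Mr; exists L => // x.
by have := fM _ ML x; rewrite -!of_real_rnorm -of_realM of_real_le.
Qed.

End LipschitzConstant.

(** * The two implications *)

Section Main.
Context (R : realType) (s : scalars) d (T : measurableType d) (P : probability T R).
Local Notation K := (scalar_field R s).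
Variable xi : nat -> {RV P >-> R}.
Hypothesis xi_iid : iid xi.
Hypothesis xi_symmetric : forall j, symmetric_rv (xi j).
Hypothesis xi_moments : forall j, finite_moments (xi j).
Hypothesis xi_normalized : forall j, ('E_P[(fun w => `|xi j w| ^+ 2)%R] = 1)%E.

Local Notation moment X x :=
  (randmoment xi (@rnorm R s X : realified X -> R) (x : _ -> realified X)).

Lemma random_sum_normE (X : normedModType K) n (x : 'I_n -> X) :
  random_sum_norm xi x = (Num.sqrt (moment X x))%:E.
Proof.
have sx := summable_randmoment xi_iid xi_symmetric xi_moments (seminorm_rnorm X)
  (x : _ -> realified X).
rewrite /random_sum_norm (ExE sx) poweR_EFin powR12_sqrt//.
exact: randmoment_ge0.
Qed.

Lemma lipschitz_hilbert (X : completeNormedModType K) :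
  (exists C : R, forall f : X -> X, lipschitz f -> f 0 = 0 ->
     forall (n : nat) (x : 'I_n -> X),
       (random_sum_norm xi (fun j => f (x j))
          <= (C * lip_const f)%:E * random_sum_norm xi x)%E) ->
  isomorphic_to_hilbert X.
Proof.
move=> [C HC]; pose V := realified X; pose N : V -> R := @rnorm R s X.
have HN : seminorm N := seminorm_rnorm X.
have N0 (v : V) : N v = 0 -> v = 0 by exact: rnorm_eq0.
have HM := randmoment_random_moment xi_iid xi_symmetric xi_moments xi_normalized HN.
have k0 : 0 < abs_mean xi ^+ 2 by rewrite exprn_gt0// abs_mean_gt0.
have m0 := fourth_moment_ge0 xi.
have ML (f : V -> V) (L : R) : 0 <= L ->
    (forall x y, N (f x - f y) <= L * N (x - y)) -> f 0 = 0 ->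
    forall n (x : 'I_n -> V),
      randmoment xi N (fun j => f (x j)) <= C ^+ 2 * L ^+ 2 * randmoment xi N x.
  move=> L0 fL f0 n x.
  have lf : (of_real s L).-lipschitz (f : X -> X) by apply/of_real_lipschitz.
  have lipf : lipschitz (f : X -> X).
    apply: (@klipschitzW _ X X (of_real s L)) => //.
    exact: (@globally_properfilter _ _ (0 : X, 0 : X)).
  have := HC f lipf f0 n x; rewrite !random_sum_normE -EFinM lee_fin => h.
  have M0 : 0 <= randmoment xi N x by exact: randmoment_ge0.
  have Mf0 : 0 <= randmoment xi N (fun j => f (x j)) by exact: randmoment_ge0.
  (* [C] may be negative, hence the absolute value; squaring then produces [C ^+ 2]. *)
  have h2 : Num.sqrt (randmoment xi N (fun j => f (x j))) <=
      `|C| * L * Num.sqrt (randmoment xi N x).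
    apply: le_trans h _; rewrite ler_wpM2r ?sqrtr_ge0//.
    apply: le_trans (ler_norm _) _; rewrite normrM ler_wpM2l//.
    by rewrite ger0_norm ?lip_const_ge0//; exact: lip_const_le.
  rewrite -(sqr_sqrtr Mf0) -(sqr_sqrtr M0) -[C ^+ 2]real_normK ?num_real// -!exprMn.
  by rewrite ler_sqr ?nnegrE ?sqrtr_ge0// !mulr_ge0 ?sqrtr_ge0.
have [T2 T20 type2] := lipschitz_type2 HN N0 k0 HM (sqr_ge0 C) ML.
have [C2 C20 cotype2] := lipschitz_cotype2 HN N0 k0 m0 HM (sqr_ge0 C) ML.
have [q qP qb] := type_cotype_parallelogram HN T20 C20 type2 cotype2.
exact: (@hilbert_of_parallelogram R s X q (C2 * T2)).
Qed.

Lemma hilbert_randmoment (H : completeNormedModType K) n (x : 'I_n -> H) :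
  is_hilbert H -> moment H x = \sum_j rnorm (x j) ^+ 2.
Proof.
move=> [ip ipE].
have qP : parallelogram (fun v : realified H => rnorm (v : H) ^+ 2).
  move=> u v; apply: (@of_real_inj R s).
  rewrite /= !(of_realD, of_realX, of_realM) !of_real_rnorm !ipE.
  rewrite !of_real1.
  rewrite linearDl linearBl !linearD !linearN /=; ring.
have [_ <-] := randmoment_signmoment xi_iid xi_symmetric xi_moments (seminorm_rnorm H)
  (x : _ -> realified H).
have sj (j : 'I_n) : summable_rv P (fun w => rnorm (x j) ^+ 2 * `|xi j w| ^+ 2).
  by apply: summableZ; exact: summable_moment.
transitivity (Ex P (fun w => \sum_(j <- enum 'I_n) rnorm (x j) ^+ 2 * `|xi j w| ^+ 2)).
  congr Ex; apply/funext => w; rewrite /signmoment (signavg_parallelogram _ _ qP).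
  rewrite (seminorm0 (seminorm_rnorm H)) expr0n add0r big_map; apply: eq_bigr => j _.
  by rewrite (seminormZ (seminorm_rnorm H)) exprMn mulrC.
rewrite Ex_sum// big_enum; apply: eq_bigr => j _.
by rewrite ExZ ?Ex_abs_sqr ?mulr1//; exact: summable_moment.
Qed.

Lemma hilbert_lipschitz (X : completeNormedModType K) : isomorphic_to_hilbert X ->
  exists C : R, forall f : X -> X, lipschitz f -> f 0 = 0 ->
     forall (n : nat) (x : 'I_n -> X),
       (random_sum_norm xi (fun j => f (x j))
          <= (C * lip_const f)%:E * random_sum_norm xi x)%E.
Proof.
move=> [H hH [S [U [SU US Sc Uc]]]].
have [a a0 Sa] := rnorm_bounded_linear Sc.
have [b b0 Ub] := rnorm_bounded_linear Uc.
(* Conjugating [f] to the Hilbert space multiplies its Lipschitz constant by at most [a b], and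
   moving the two random sums across costs another [a b]. *)
exists (a ^+ 2 * b ^+ 2) => f lipf f0 n x.
have l0 := lip_const_ge0 lipf.
have fl (u : X) : rnorm (f u) <= lip_const f * rnorm u.
  by have := lip_constP u 0 lipf; rewrite f0 !subr0.
have sq (Y Z : normedModType K) (c : R) (y : Y) (z : Z) : 0 <= c ->
    rnorm y <= c * rnorm z -> rnorm y ^+ 2 <= c ^+ 2 * rnorm z ^+ 2.
  by move=> c0 h; rewrite -exprMn ler_sqr ?nnegrE ?mulr_ge0 ?rnorm_ge0.
have transfer (Y Z : completeNormedModType K) (A : {linear Y -> Z}) (c : R) (y : 'I_n -> Y) :
    0 <= c -> (forall v, rnorm (A v) <= c * rnorm v) ->
    moment Z (fun j => A (y j)) <= c ^+ 2 * moment Y y.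
  move=> c0 Ac; rewrite /randmoment.
  have sY := summable_randmoment xi_iid xi_symmetric xi_moments (seminorm_rnorm Y)
    (y : _ -> realified Y).
  have sZ := summable_randmoment xi_iid xi_symmetric xi_moments (seminorm_rnorm Z)
    ((fun j => A (y j)) : _ -> realified Z).
  rewrite -ExZ//; apply: le_Ex => //; first exact: summableZ.
  move=> w; have -> : \sum_(j < n) xi j w *: (A (y j) : realified Z) =
      A (\sum_(j < n) (of_real s (xi j w) : K) *: y j).
    by rewrite linear_sum; apply: eq_bigr => j _; rewrite linearZ.
  exact: sq.
have h1 := transfer H X U b (fun j => S (f (x j))) b0 Ub.
have h2 := transfer X H S a x a0 Sa.
rewrite (hilbert_randmoment _ hH) in h1; rewrite (hilbert_randmoment _ hH) in h2.
have USf : (fun j => U (S (f (x j)))) = (fun j => f (x j)).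
  by apply/funext => j; rewrite SU.
rewrite USf in h1.
have h3 : \sum_j rnorm (S (f (x j))) ^+ 2 <=
    (a * lip_const f * b) ^+ 2 * \sum_j rnorm (S (x j)) ^+ 2.
  rewrite mulr_sumr; apply: ler_sum => j _.
  apply: sq; first by rewrite !mulr_ge0.
  apply: le_trans (Sa _) _; rewrite -!mulrA ler_wpM2l//.
  apply: le_trans (fl _) _; rewrite ler_wpM2l//.
  by have := Ub (S (x j)); rewrite SU.
rewrite !random_sum_normE -EFinM lee_fin.
have M0 : 0 <= moment X x by exact: randmoment_ge0.
have -> : a ^+ 2 * b ^+ 2 * lip_const f * Num.sqrt (moment X x) =
    Num.sqrt ((a ^+ 2 * b ^+ 2 * lip_const f) ^+ 2 * moment X x).
  by rewrite sqrtrM ?sqr_ge0// sqrtr_sqr ger0_norm// !mulr_ge0.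
rewrite ler_wsqrtr//; apply: le_trans h1 _.
apply: (@le_trans _ _ (b ^+ 2 * ((a * lip_const f * b) ^+ 2 * (a ^+ 2 * moment X x)))).
  rewrite ler_wpM2l ?sqr_ge0//; apply: le_trans h3 _.
  by rewrite ler_wpM2l ?sqr_ge0.
by rewrite le_eqVlt; apply/orP; left; apply/eqP; ring.
Qed.

End Main.

Theorem mainTheorem1 (R : realType) (s : scalars)
  (X : completeNormedModType (scalar_field R s))
  (d : measure_display) (T : measurableType d) (P : probability T R)
  (xi : nat -> {RV P >-> R})
  (xi_iid : iid xi)
  (xi_symmetric : forall j, symmetric_rv (xi j))
  (xi_moments : forall j, finite_moments (xi j))
  (xi_normalized : forall j, ('E_P[(fun w => `|xi j w| ^+ 2)%R] = 1)%E) :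
  (exists K : R, forall f : X -> X, lipschitz f -> f 0 = 0 ->
     forall (n : nat) (x : 'I_n -> X),
       (random_sum_norm xi (fun j => f (x j))
          <= (K * lip_const f)%:E * random_sum_norm xi x)%E)
  <-> isomorphic_to_hilbert X.
Proof.
split; first exact: lipschitz_hilbert.
exact: hilbert_lipschitz.
Qed.
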